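(* Let $\mathfrak{S}$ be an operator system and let $\mathfrak{A}=\mathrm{C}^*(\mathfrak{S})$. Assume that every irreducible $*$-representation of $\mathfrak{A}$ is a boundary representation for $\mathfrak{S}$. Let $\pi:\mathfrak{A}\to B(\mathcal{H})$ be a unital $*$-representation and let $\Pi:\mathfrak{A}\to B(\mathcal{H})$ be a unital completely positive extension of $\pi|_{\mathfrak{S}}$. Then, the subspace $(\pi-\Pi)(\mathfrak{A})$ contains no strictly positive element.
   Context: An operator system is a unital self-adjoint subspace $\mathfrak{S}$ of $B(\mathcal{K})$ for some Hilbert space $\mathcal{K}$; $\mathrm{C}^*(\mathfrak{S})$ is the $\mathrm{C}^*$-algebra it generates. A linear map on an operator system is completely positive if all its matrix amplifications are positive. An irreducible $*$-representation $\sigma:\mathrm{C}^*(\mathfrak{S})\to B(\mathcal{K}_\sigma)$ is a boundary representation for $\mathfrak{S}$ if the only completely positive map $\mathrm{C}^*(\mathfrak{S})\to B(\mathcal{K}_\sigma)$ extending $\sigma|_{\mathfrak{S}}$ is $\sigma$ itself. An operator $x\in B(\mathcal{H})$ is strictly positive if $x\ge \delta I$ for some $\delta>0$. *)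

(* Defs.v *)
From HB Require Import structures.
From mathcomp Require Import all_boot all_order all_algebra.
From mathcomp Require Import sesquilinear.
From mathcomp Require Import complex.
From mathcomp Require Import ring lra.
From mathcomp Require Import all_classical all_reals all_analysis.

Set Implicit Arguments.
Unset Strict Implicit.
Unset Printing Implicit Defensive.

Import Order.TTheory GRing.Theory Num.Theory.
Import numFieldNormedType.Exports.

Local Open Scope classical_set_scope.
Local Open Scope ring_scope.

(* Complex Hilbert spaces; [inner] is linear in its first argument and
   conjugate-linear in its second one. *)
Record hilbert (R : realType) := Hilbert {
  hilbert_sort :> completeNormedModType R[i] ;
  inner : {dot hilbert_sort for (@Num.conj R[i])} ;
  sqr_normE : forall x : hilbert_sort, `|x| ^+ 2 = inner x x }.

Local Notation "''[' x , y ]" := (inner _ x y) : ring_scope.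

Section HilbertTheory.
Variables (R : realType) (H : hilbert R).
Implicit Types (x y z : H) (a : R[i]).

Lemma innerC x y : '[x, y] = ('[y, x])^*.
Proof. by have := @hermitian_subproof _ _ _ _ (inner H) x y; rewrite expr0 mul1r. Qed.

Lemma innerDl x y z : '[x + y, z] = '[x, z] + '[y, z].
Proof. exact: linearDl. Qed.
Lemma innerZl a x z : '[a *: x, z] = a * '[x, z].
Proof. exact: linearZl_LR. Qed.
Lemma innerBl x y z : '[x - y, z] = '[x, z] - '[y, z].
Proof. exact: linearBl. Qed.
Lemma innerDr x y z : '[z, x + y] = '[z, x] + '[z, y].
Proof. exact: linearDr. Qed.
Lemma innerBr x y z : '[z, x - y] = '[z, x] - '[z, y].
Proof. exact: linearBr. Qed.
Lemma innerZr a x z : '[z, a *: x] = a^* * '[z, x].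
Proof. exact: linearZr_LR. Qed.
Lemma inner0l z : '[0, z] = 0. Proof. by rewrite -[0](scale0r 0) innerZl mul0r. Qed.
Lemma inner0r z : '[z, 0] = 0. Proof. by rewrite innerC inner0l conjC0. Qed.

End HilbertTheory.


Section CauchySchwarz.
Variables (R : realType) (H : hilbert R).
Implicit Types (x y z : H) (a : R[i]).

Lemma cauchy_schwarz x y : `|'[x, y]| <= `|x| * `|y|.
Proof.
have [->|y0] := eqVneq y 0; first by rewrite inner0r !normr0 mulr0.
pose n := `|y| ^+ 2.
have ny0 : 0 < n by rewrite exprn_gt0// normr_gt0.
rewrite -(@ler_pXn2r _ 2%N)// ?nnegrE ?mulr_ge0// exprMn.
rewrite -(ler_pM2r ny0).
have nR : n^* = n by apply: CrealP; rewrite gtr0_real.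
have : 0 <= `|n *: x - '[x, y] *: y| ^+ 2 by rewrite exprn_ge0.
rewrite sqr_normE !(innerBl, innerBr, innerZl, innerZr) nR -!sqr_normE -/n.
rewrite (innerC y x) -/n normCK.
set p := '[x, y]; set q := p^*; set m := `|x| ^+ 2.
have key (a b c d : R[i]) :
  a * (a * b) - a * (c * d) - (d * (a * c) - d * (c * a)) = a * (b * a - d * c).
  by ring.
rewrite key.
rewrite pmulr_rge0// subr_ge0 => h.
by rewrite ler_pM2r.
Qed.

Lemma inner_continuousl y : continuous (fun x => '[x, y] : R[i]^o).
Proof.
have lf : linear (fun x => '[x, y] : R[i]^o).
  by move=> a u v; rewrite innerDl innerZl.
pose f' := GRing.isLinear.Build _ _ _ _ _ lf.
pose f : {linear H -> R[i]^o} := HB.pack (fun x => '[x, y] : R[i]^o) f'.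
apply: (@bounded_linear_continuous _ _ _ f).
apply/linear_boundedP; exists `|y|; split; first exact: normr_real.
move=> r yr x /=; rewrite (le_trans (cauchy_schwarz _ _))// mulrC.
by apply: ler_wpM2r => //; exact: ltW.
Qed.

End CauchySchwarz.

Section Riesz.
Variables (R : realType) (H : hilbert R).
Implicit Types (x y z : H) (a : R[i]).

Let N2 x : R := complex.Re '[x, x].

Let N2E x : (N2 x)%:C%C = '[x, x].
Proof. by apply: RRe_real; rewrite ger0_real// -sqr_normE exprn_ge0. Qed.

Let N2_ge0 x : 0 <= N2 x.
Proof. by rewrite -(@lecR R) N2E -sqr_normE exprn_ge0. Qed.

Let inv_small (c : R) (e : R[i]) : 0 <= c -> 0 < e ->
  \forall n \near \oo, (c * n.+1%:R^-1)%:C%C < e ^+ 2.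
Proof.
move=> c0 e0.
have eE : (complex.Re e)%:C%C = e by apply: RRe_real; rewrite gtr0_real.
have re0 : 0 < complex.Re e by rewrite -(@ltcR R) eE.
have d0 : 0 < complex.Re e ^+ 2 / (c + 1).
  by rewrite divr_gt0// ?exprn_gt0// ltr_wpDl.
near=> n.
rewrite -eE -rmorphXn/= ltcR.
have : n.+1%:R^-1 < complex.Re e ^+ 2 / (c + 1).
  near: n; exact: (near_infty_natSinv_lt (PosNum d0)).
rewrite ltr_pdivlMr ?ltr_wpDl// => h; apply: le_lt_trans h.
by rewrite mulrC ler_wpM2l// lerDl.
Unshelve. all: by end_near. Qed.

Let norm_lt_sqr x (e : R[i]) : 0 < e -> '[x, x] < e ^+ 2 -> `|x| < e.
Proof.
by move=> e0; rewrite -sqr_normE ltr_pXn2r// nnegrE// ltW.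
Qed.

Let lim_uniq (v : nat -> R[i]^o) (a b : R[i]^o) :
  v @ \oo --> a -> v @ \oo --> b -> a = b.
Proof. exact: (@cvg_unique _ (@norm_hausdorff _ R[i]^o)). Qed.

Let parallelogram x y : N2 (x - y) = 2 * N2 x + 2 * N2 y - 4 * N2 (2^-1 *: (x + y)).
Proof.
apply: (@complexI R); rewrite !(rmorphB, rmorphD, rmorphM)/= !N2E.
rewrite !(innerBl, innerBr, innerZl, innerZr, innerDl, innerDr).
rewrite fmorphV/= !rmorph_nat.
by field.
Qed.

Let minimizing (f : {linear H -> R[i]^o}) : (exists x, f x != 0) ->
  exists (d : R) (u : nat -> H), [/\ forall n, f (u n) = 1,
    forall x, f x = 1 -> d <= N2 x & forall n, N2 (u n) < d + n.+1%:R^-1].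
Proof.
move=> [x0 fx0].
pose E := [set N2 x | x in [set x | f x = 1]].
have E0 : has_inf E.
  split; last by exists 0 => _ [x _ <-].
  exists (N2 ((f x0)^-1 *: x0)); exists ((f x0)^-1 *: x0) => //=.
  by rewrite linearZ/= [_ *: _]mulVf.
have /choice[u uP] : forall n : nat, exists x, f x = 1 /\ N2 x < inf E + n.+1%:R^-1.
  move=> n; have n0 : 0 < n.+1%:R^-1 :> R by rewrite invr_gt0.
  by have [_ [x fx <-] h] := inf_adherent n0 E0; exists x.
exists (inf E), u; split=> [n|x fx|n]; [by case: (uP n)| |by case: (uP n)].
by apply: ge_inf; [case: E0|exists x].
Qed.

Lemma riesz (f : {linear H -> R[i]^o}) : continuous f ->
  exists z, forall x, f x = '[x, z].
Proof.
move=> cf; have [/forallNP f0|] := pselect (~ exists x, f x != 0).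
  by exists 0 => x; rewrite inner0r; have /negP := f0 x; rewrite negbK => /eqP.
move=> /contrapT /minimizing [d [u [fu dmin ud]]].
have ucauchy : cauchy (u @ \oo).
  apply: cauchy_exP => e e0.
  have [N _ hN] := inv_small (ler0n _ 4) e0.
  exists (u N); exists N => // k /= Nk.
  rewrite -ball_normE/=; apply: norm_lt_sqr => //.
  apply: le_lt_trans (hN N (leqnn N)); rewrite -N2E lecR parallelogram.
  have h : d <= N2 (2^-1 *: (u N + u k)).
    apply: dmin; rewrite linearZ linearD/= !fu.
    by rewrite [_ *: _]mulVf// -[1 + 1]/(2%:R : R[i]) pnatr_eq0.
  have kN : k.+1%:R^-1 <= N.+1%:R^-1 :> R by rewrite lef_pV2 ?posrE// ler_nat.
  have key (a b c p q : R) : d <= c -> p <= q -> b < d + p -> a < d + q ->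
    2 * a + 2 * b - 4 * c <= 4 * q by lra.
  exact: key h kN (ud k) (ud N).
have /cvg_ex[z uz] : cvg (u @ \oo) by exact: cauchy_cvg.
have fz : f z = 1.
  have h : (f \o u) @ \oo --> f z by apply: cvg_comp uz _; apply: cf.
  apply: (lim_uniq h).
  by rewrite (_ : f \o u = cst 1); [exact: cvg_cst|apply/funext => n /=].
have orth k : f k = 0 -> '[k, z] = 0.
  move=> fk; have [->|k0] := eqVneq k 0; first by rewrite inner0l.
  have Nk0 : 0 < N2 k by rewrite -(@ltcR R) N2E -sqr_normE exprn_gt0// normr_gt0.
  rewrite innerC; apply/eqP; rewrite conjC_eq0; apply/eqP.
  have small n : `|'[u n, k]| ^+ 2 <= (N2 k * n.+1%:R^-1)%:C%C.
    have [w wE] : exists w : R, w%:C%C = `|'[u n, k]| ^+ 2.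
      by exists (complex.Re (`|'[u n, k]| ^+ 2)); rewrite RRe_real// rpredX.
    pose t := (N2 k)%:C%C^-1 * '[u n, k].
    have : d <= N2 (u n - t *: k).
      by apply: dmin; rewrite linearB linearZ/= fk fu scaler0 subr0.
    have -> : N2 (u n - t *: k) = N2 (u n) - w / N2 k.
      apply: (@complexI R); rewrite rmorphB rmorphM/= fmorphV wE !N2E normCK /t.
      rewrite !(innerBl, innerBr, innerZl, innerZr) (innerC k (u n)) !N2E.
      rewrite rmorphM/= fmorphV/= -!innerC.
      have nk : '[k, k] != 0 by rewrite -N2E gt_eqF// ltcR.
      move: nk; set a := '[k, k]; set p := '[u n, k]; set q := '[k, u n].
      set b := '[u n, u n] => a0; rewrite -[X in _ / X]/((N2 k)%:C%C) N2E -/a.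
      have key (A B P Q : R[i]) : A != 0 ->
        B - A^-1 * Q * P - (A^-1 * P * Q - A^-1 * P * (A^-1 * Q * A)) =
        B - P * Q / A by move=> ?; field.
      exact: key.
    have := ud n => h1 h2.
    have key (a b c : R) : d <= a - c -> a < d + b -> c <= b by lra.
    have : w / N2 k <= n.+1%:R^-1 := key _ _ _ h2 h1.
    by rewrite ler_pdivrMr// mulrC -(@lecR R) wE.
  have h : (fun n => '[u n, k] : R[i]^o) @ \oo --> ('[z, k] : R[i]^o).
    exact: cvg_comp uz (@inner_continuousl _ _ k z).
  apply: (lim_uniq h).
  apply/cvgr0Pnorm_lt => e e0; near=> n.
  rewrite -(@ltr_pXn2r _ 2%N)// ?nnegrE ?(ltW e0)//.
  apply: (le_lt_trans (small n)); near: n.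
  exact: inv_small (ltW Nk0) e0.
have z0 : '[z, z] != 0.
  rewrite -sqr_normE expf_eq0/= normr_eq0; apply/eqP => z0.
  by move: fz; rewrite z0 linear0 => /esym/eqP; rewrite oner_eq0.
exists ('[z, z]^-1 *: z) => x; rewrite innerZr fmorphV/= -innerC.
have : '[x - f x *: z, z] = 0.
  by apply: orth; rewrite linearB linearZ/= fz [_ *: _]mulr1 subrr.
by rewrite innerBl innerZl => /eqP; rewrite subr_eq0 => /eqP ->; rewrite mulrCA mulVf// mulr1.
Unshelve. all: by end_near. Qed.

End Riesz.

Record bop (R : realType) (H : hilbert R) := Bop {
  bop_fun :> H -> H ;
  bop_linear : linear bop_fun ;
  bop_continuous : continuous bop_fun }.

HB.instance Definition _ (R : realType) (H : hilbert R) (T : bop H) :=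
  GRing.isLinear.Build R[i] H H _ (bop_fun T) (bop_linear T).

Section BopAlgebra.
Variables (R : realType) (H : hilbert R).
Implicit Types (T U V : bop H) (a : R[i]) (x y : H).

Lemma bopP T U : T =1 U -> T = U.
Proof.
case: T U => [f lf cf] [g lg cg] /= /funext fg; subst g.
by rewrite (Prop_irrelevance lf lg) (Prop_irrelevance cf cg).
Qed.

HB.instance Definition _ := gen_eqMixin (bop H).
HB.instance Definition _ := gen_choiceMixin (bop H).

Let add_lin T U : linear (fun x => T x + U x).
Proof. by move=> a x y; rewrite !linearP scalerDr addrACA. Qed.
Let add_cont T U : continuous (fun x => T x + U x).
Proof. by move=> x; apply: cvgD; exact: bop_continuous. Qed.
Definition bop_add T U := Bop (@add_lin T U) (@add_cont T U).

Let opp_lin T : linear (fun x => - T x).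
Proof. by move=> a x y; rewrite linearP opprD scalerN. Qed.
Let opp_cont T : continuous (fun x => - T x).
Proof. by move=> x; apply: cvgN; exact: bop_continuous. Qed.
Definition bop_opp T := Bop (@opp_lin T) (@opp_cont T).

Let zero_lin : linear (fun _ : H => 0 : H).
Proof. by move=> a x y; rewrite scaler0 addr0. Qed.
Let zero_cont : continuous (fun _ : H => 0 : H).
Proof. by move=> x; exact: cvg_cst. Qed.
Definition bop_zero := Bop zero_lin zero_cont.

Let scale_lin a T : linear (fun x => a *: T x).
Proof. by move=> b x y; rewrite linearP scalerDr !scalerA mulrC. Qed.
Let scale_cont a T : continuous (fun x => a *: T x).
Proof. by move=> x; apply: cvgZl_tmp; exact: bop_continuous. Qed.
Definition bop_scale a T := Bop (@scale_lin a T) (@scale_cont a T).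

Let one_lin : linear (fun x : H => x).
Proof. by []. Qed.
Let one_cont : continuous (fun x : H => x).
Proof. by move=> x; exact: cvg_id. Qed.
Definition bop_one := Bop one_lin one_cont.

Let mul_lin T U : linear (fun x => T (U x)).
Proof. by move=> a x y; rewrite !linearP. Qed.
Let mul_cont T U : continuous (fun x => T (U x)).
Proof.
by move=> x; apply: continuous_comp; exact: bop_continuous.
Qed.
Definition bop_mul T U := Bop (@mul_lin T U) (@mul_cont T U).

Let bop_addA : associative bop_add.
Proof. by move=> T U V; apply: bopP => x /=; rewrite addrA. Qed.
Let bop_addC : commutative bop_add.
Proof. by move=> T U; apply: bopP => x /=; rewrite addrC. Qed.
Let bop_add0 : left_id bop_zero bop_add.
Proof. by move=> T; apply: bopP => x /=; rewrite add0r. Qed.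
Let bop_addN : left_inverse bop_zero bop_opp bop_add.
Proof. by move=> T; apply: bopP => x /=; rewrite addNr. Qed.

HB.instance Definition _ :=
  GRing.isZmodule.Build (bop H) bop_addA bop_addC bop_add0 bop_addN.

Let bop_mulA : associative bop_mul.
Proof. by move=> T U V; apply: bopP. Qed.
Let bop_mul1 : left_id bop_one bop_mul.
Proof. by move=> T; apply: bopP. Qed.
Let bop_1mul : right_id bop_one bop_mul.
Proof. by move=> T; apply: bopP. Qed.
Let bop_mulDl : left_distributive bop_mul +%R.
Proof. by move=> T U V; apply: bopP. Qed.
Let bop_mulDr : right_distributive bop_mul +%R.
Proof. by move=> T U V; apply: bopP => x /=; rewrite linearD. Qed.

HB.instance Definition _ := GRing.Zmodule_isPzRing.Build (bop H)
  bop_mulA bop_mul1 bop_1mul bop_mulDl bop_mulDr.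

Let bop_scaleA a b T : bop_scale a (bop_scale b T) = bop_scale (a * b) T.
Proof. by apply: bopP => x /=; rewrite scalerA. Qed.
Let bop_scale1 : left_id 1 bop_scale.
Proof. by move=> T; apply: bopP => x /=; rewrite scale1r. Qed.
Let bop_scaleDr : right_distributive bop_scale +%R.
Proof. by move=> a T U; apply: bopP => x /=; rewrite scalerDr. Qed.
Let bop_scaleDl T : {morph bop_scale^~ T : a b / a + b}.
Proof. by move=> a b; apply: bopP => x /=; rewrite scalerDl. Qed.

HB.instance Definition _ := GRing.Zmodule_isLmodule.Build R[i] (bop H)
  bop_scaleA bop_scale1 bop_scaleDr bop_scaleDl.

Lemma bop_addE T U x : (T + U) x = T x + U x. Proof. by []. Qed.
Lemma bop_oppE T x : (- T) x = - T x. Proof. by []. Qed.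
Lemma bop_subE T U x : (T - U) x = T x - U x. Proof. by []. Qed.
Lemma bop_zeroE x : (0 : bop H) x = 0. Proof. by []. Qed.
Lemma bop_scaleE a T x : (a *: T) x = a *: T x. Proof. by []. Qed.
Lemma bop_oneE x : (1 : bop H) x = x. Proof. by []. Qed.
Lemma bop_mulE T U x : (T * U) x = T (U x). Proof. by []. Qed.

End BopAlgebra.

Section BopNorm.
Variables (R : realType) (H : hilbert R).
Implicit Types (T U V : bop H) (a : R[i]) (x y : H).

Definition opnorm T : R :=
  sup [set complex.Re `|T x| | x in [set x : H | `|x| <= 1]].

Let normRe x : (complex.Re `|x|)%:C%C = `|x|.
Proof. by apply: RRe_real; rewrite normr_real. Qed.

Let bounded T : exists M : R, 0 <= M /\ forall x, `|T x| <= M%:C%C * `|x|.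
Proof.
pose f : {linear H -> H} := bop_fun T.
have /linear_boundedP : bounded_near f (nbhs 0).
  by apply/linear_bounded_continuous; exact: bop_continuous.
case=> M [Mr hM].
have h : M < `|M| + 1 by rewrite (le_lt_trans (real_ler_norm Mr))// ltrDl.
exists (complex.Re (`|M| + 1)).
have E : (complex.Re (`|M| + 1))%:C%C = `|M| + 1.
  by apply: RRe_real; rewrite ger0_real// addr_ge0.
by split=> [|x]; [rewrite -(@lecR R) E addr_ge0|rewrite E; exact: (hM _ h x)].
Qed.

Let has_sup_opnorm T :
  has_sup [set complex.Re `|T x| | x in [set x : H | `|x| <= 1]].
Proof.
split; first by exists (complex.Re `|T 0|); exists 0 => //=; rewrite normr0.
have [M [M0 hM]] := bounded T; exists M => _ [x /= x1 <-].
rewrite -(@lecR R) normRe (le_trans (hM x))//.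
by rewrite ler_piMr// lecR.
Qed.

Lemma opnorm_ge0 T : 0 <= opnorm T.
Proof.
have h : 0 <= complex.Re `|T 0| by rewrite -(@lecR R) normRe; exact: normr_ge0.
apply: (le_trans h); apply: sup_upper_bound; first exact: has_sup_opnorm.
by exists 0 => //=; rewrite normr0.
Qed.

Lemma le_opnorm T x : `|T x| <= (opnorm T)%:C%C * `|x|.
Proof.
have [->|x0] := eqVneq x 0; first by rewrite linear0 !normr0 mulr0.
rewrite -ler_pdivrMr ?normr_gt0//.
have -> : `|T x| / `|x| = `|T (`|x|^-1 *: x)|.
  by rewrite linearZ/= normrZ normfV normr_id mulrC.
rewrite -normRe lecR; apply: sup_upper_bound; first exact: has_sup_opnorm.
exists (`|x|^-1 *: x) => //=.
by rewrite normrZ normfV normr_id mulVf// normr_eq0.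
Qed.

Lemma opnorm_le T (M : R) : 0 <= M -> (forall x, `|T x| <= M%:C%C * `|x|) ->
  opnorm T <= M.
Proof.
move=> M0 hM; apply: ge_sup; first by case: (has_sup_opnorm T).
move=> _ [x /= x1 <-]; rewrite -(@lecR R) normRe (le_trans (hM x))//.
by rewrite ler_piMr// lecR.
Qed.

Let opnormD T U : (opnorm (T + U))%:C%C <= (opnorm T)%:C%C + (opnorm U)%:C%C.
Proof.
rewrite -rmorphD lecR; apply: opnorm_le => [|x].
  by rewrite addr_ge0// opnorm_ge0.
by rewrite rmorphD mulrDl (le_trans (ler_normD _ _))// lerD// le_opnorm.
Qed.

Let opnormZ a T : (opnorm (a *: T))%:C%C = `|a| * (opnorm T)%:C%C.
Proof.
have le b U : (opnorm (b *: U))%:C%C <= `|b| * (opnorm U)%:C%C.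
  have [c bE] : exists c : R, c%:C%C = `|b|.
    by exists (complex.Re `|b|); apply: RRe_real; rewrite normr_real.
  rewrite -bE -rmorphM lecR; apply: opnorm_le => [|x].
    by rewrite mulr_ge0 ?opnorm_ge0// -(@lecR R) bE; exact: normr_ge0.
  by rewrite rmorphM/= bE normrZ -mulrA ler_wpM2l// le_opnorm.
apply/le_anti/andP; split; first exact: le.
have [->|a0] := eqVneq a 0.
  by rewrite normr0 mul0r; have := opnorm_ge0 (0 *: T); rewrite -(@lecR R).
have := le a^-1 (a *: T); rewrite scalerA mulVf// scale1r normfV mulrC.
by rewrite ler_pdivlMr ?normr_gt0// mulrC.
Qed.

Let opnorm0_eq0 T : (opnorm T)%:C%C = 0 -> T = 0.
Proof.
move=> T0; apply: bopP => x; apply/eqP; rewrite -normr_le0.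
by apply: (le_trans (le_opnorm T x)); rewrite T0 mul0r.
Qed.

HB.instance Definition _ := Lmodule_isNormed.Build R[i] (bop H)
  opnormD opnormZ opnorm0_eq0.

Lemma bop_normE T : `|T| = (opnorm T)%:C%C. Proof. by []. Qed.

End BopNorm.

Section Adjoint.
Variables (R : realType) (H : hilbert R).
Implicit Types (T U : bop H) (x y z : H).

Let inner_inj y z : (forall x, '[x, y] = '[x, z]) -> y = z.
Proof.
move=> h; apply/eqP; rewrite -subr_eq0 -normr_eq0 -sqrf_eq0 sqr_normE.
by rewrite innerBr h subrr.
Qed.

Let adj_ex_vec T y : exists z, forall x, '[T x, y] = '[x, z].
Proof.
have lf : linear (fun x => '[T x, y] : R[i]^o).
  by move=> a u v; rewrite linearP innerDl innerZl.
pose f' := GRing.isLinear.Build _ _ _ _ _ lf.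
pose f : {linear H -> R[i]^o} := HB.pack (fun x => '[T x, y] : R[i]^o) f'.
apply: (@riesz _ _ f) => x.
apply: (@continuous_comp _ _ _ T (fun v => '[v, y] : R[i]^o)).
  exact: bop_continuous.
exact: inner_continuousl.
Qed.

Lemma adj_ex T : exists U, forall x y, '[T x, y] = '[x, U y].
Proof.
have [g gP] := choice (adj_ex_vec T).
have lg : linear g.
  move=> a u v; apply: inner_inj => x.
  by rewrite -gP !(innerDr, innerZr) -!gP.
pose g' := GRing.isLinear.Build _ _ _ _ _ lg.
pose G : {linear H -> H} := HB.pack g g'.
suff cg : continuous g by exists (Bop lg cg) => x y; rewrite gP.
apply: (@bounded_linear_continuous _ _ _ G).
apply/linear_boundedP; exists `|T|; split; first exact: normr_real.
move=> r Tr x /=; apply: (@le_trans _ _ (`|T| * `|x|)); last first.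
  by apply: ler_wpM2r => //; exact: ltW.
have [->|gx0] := eqVneq (g x) 0; first by rewrite normr0 mulr_ge0.
have ngx : 0 < `|g x| by rewrite normr_gt0.
rewrite -(ler_pM2r ngx) -expr2 sqr_normE -gP.
have -> : '[T (g x), x] = `|'[T (g x), x]|.
  by rewrite ger0_norm// gP -sqr_normE exprn_ge0.
apply: (le_trans (cauchy_schwarz _ _)); rewrite mulrAC.
by apply: ler_wpM2r => //; exact: le_opnorm.
Qed.

Definition adj T : bop H := projT1 (cid (adj_ex T)).

Lemma adjP T x y : '[T x, y] = '[x, adj T y].
Proof. by rewrite /adj; case: cid. Qed.

Lemma adj_unique T U : (forall x y, '[T x, y] = '[x, U y]) -> U = adj T.
Proof.
by move=> h; apply: bopP => y; apply: inner_inj => x; rewrite -h adjP.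
Qed.

End Adjoint.

Definition linear_subspace (C : numFieldType) (V : lmodType C) (E : set V) :=
  E 0 /\ forall (a : C) u v, E u -> E v -> E (a *: u + v).

Section Operators.
Variables (R : realType) (H : hilbert R).
Implicit Types (T : bop H) (A S : set (bop H)).

(* On a complex Hilbert space [0 <= '[T x, x]] for all x forces T = adj T;
   in [R[i]] the order makes [0 <= z] mean "z is real and nonnegative". *)
Definition positive_op T := forall x : H, 0 <= '[T x, x].

Definition strictly_positive_op T :=
  exists2 delta : R, 0 < delta & positive_op (T - delta%:C%C *: (1 : bop H)).

(* Positivity in M_n(B(H)) = B(H^n): the quadratic form on H^n of the operator
   (x_j)_j |-> (sum_j (M i j) x_j)_i is nonnegative. *)
Definition positive_mx n (M : 'M[bop H]_n) :=
  forall x : 'I_n -> H, 0 <= \sum_(i < n) '[\sum_(j < n) M i j (x j), x i].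

(* No norm-closedness is required of an operator system. *)
Definition operator_system S :=
  [/\ linear_subspace S, S 1 & forall T, S T -> S (adj T)].

Definition cstar_subalgebra A :=
  [/\ linear_subspace A, forall T U, A T -> A U -> A (T * U),
      forall T, A T -> A (adj T) & closed A].

Definition cstar_gen S : set (bop H) := smallest cstar_subalgebra S.

End Operators.

(* Maps out of a subspace E of B(K) are total functions on B(K) of which only
   the values on E matter. *)
Section Maps.
Variables (R : realType) (K H : hilbert R).
Implicit Types (E A S : set (bop K)) (phi sigma : bop K -> bop H).

Definition linear_map_on E phi :=
  forall (a : R[i]) T U, E T -> E U -> phi (a *: T + U) = a *: phi T + phi U.

Definition completely_positive E phi :=
  linear_map_on E phi /\
  forall n (M : 'M[bop K]_n), (forall i j, E (M i j)) ->
    positive_mx M -> positive_mx (map_mx phi M).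

Definition star_representation A sigma :=
  [/\ linear_map_on A sigma,
      forall T U, A T -> A U -> sigma (T * U) = sigma T * sigma U
    & forall T, A T -> sigma (adj T) = adj (sigma T)].

(* Nonzero, and without closed invariant subspaces other than 0 and H. *)
Definition irreducible_on A sigma :=
  (exists2 T, A T & sigma T <> 0) /\
  forall V : set H, linear_subspace V -> closed V ->
    (forall T v, A T -> V v -> V (sigma T v)) -> V = [set 0] \/ V = setT.

Definition irreducible_representation A sigma :=
  star_representation A sigma /\ irreducible_on A sigma.

Definition boundary_representation S sigma :=
  irreducible_representation (cstar_gen S) sigma /\
  forall phi, completely_positive (cstar_gen S) phi ->
    (forall T, S T -> phi T = sigma T) ->
    forall T, cstar_gen S T -> phi T = sigma T.

End Maps.

(* Main.v *)
Require Import Defs.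
From HB Require Import structures.
From mathcomp Require Import all_boot all_order all_algebra.
From mathcomp Require Import sesquilinear.
From mathcomp Require Import complex.
From mathcomp Require Import ring lra.
From mathcomp Require Import all_classical all_reals all_analysis.

Set Implicit Arguments.
Unset Strict Implicit.
Unset Printing Implicit Defensive.

Import Order.TTheory GRing.Theory Num.Theory.
Import numFieldNormedType.Exports.

Local Open Scope classical_set_scope.
Local Open Scope ring_scope.

(** Let [A] be the C*-algebra generated by [S]. The idea is to find one state
    [w] of [B(H)] that cannot tell [pi] from [Pi] on [A]: since
    [w (pi T) = w (Pi T)], no [pi T - Pi T] dominates a positive multiple of 1.

    Take [w] such that its restriction to [D = pi(A)] is a pure state of [D],
    and let [L] be the Hilbert space completion of [D] for the form
    [(b, c) |-> w (adj c * b)], with cyclic vector [xi] the class of 1. Every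
    [x] in [B(H)], not only in [D], has a compression [gns x] to [L], defined by
    [<gns x b, c> = w (adj c * x * b)] for [b] and [c] in [D]; this is
    the GNS representation of [w] on [B(H)] cut down to the closure of
    [D xi]. The map [gns] is unital and completely positive, is multiplicative
    on [D], and [<gns x xi, xi> = w x]. Purity of [w] on [D] makes [gns \o pi]
    an irreducible representation of [A], hence a boundary representation for
    [S]. But [gns \o Pi] is a completely positive map that agrees with
    [gns \o pi] on [S], so the two agree on [A], and evaluating
    at [xi] gives [w (Pi T) = w (pi T)].

    The existence of [w] is Krein-Milman combined with Hahn-Banach, obtained
    by a single application of Zorn's lemma to the sublinear functionals below the
    numerical supremum [x |-> sup Re <x h, h>]: see [extreme_minorant] and
    [exists_relatively_pure_state]. The space [L] comes from
    [hilbert_completion], the compression from [form_operator]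
    (lemma [compressed_gns]), and irreducibility from the
    orthogonal projection onto an invariant subspace ([gns_irreducible]). *)

Local Notation "''[' x , y ]" := (inner _ x y) : ring_scope.

(** * Limits in complex normed spaces *)

Lemma linear_morphB (R : realType) (U W : lmodType R[i]) (f : U -> W) :
  linear f -> {morph f : x y / x - y}.
Proof. by move=> fl x y; rewrite addrC -scaleN1r fl scaleN1r addrC. Qed.

Section ComplexLimits.
Variable R : realType.
Implicit Types (V W : normedModType R[i]).

(** All approximations below are made with errors [C * rate n]: such errors are
    stable under linear combinations, which keeps the constants explicit. *)
Definition rate (n : nat) : R[i] := n.+1%:R^-1.

Lemma rate_gt0 n : 0 < rate n.
Proof. by rewrite invr_gt0 ltr0n. Qed.

Lemma rate_ge0 n : 0 <= rate n.
Proof. exact/ltW/rate_gt0. Qed.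

Lemma rate_le m n : (m <= n)%N -> rate n <= rate m.
Proof. by move=> mn; rewrite lef_pV2 ?posrE ?ltr0n// ler_nat ltnS. Qed.

Lemma gt0_RRe (e : R[i]) : 0 < e -> (complex.Re e)%:C%C = e /\ 0 < complex.Re e.
Proof.
move=> e0; have eE : (complex.Re e)%:C%C = e by apply: RRe_real; rewrite gtr0_real.
by split=> //; rewrite -(@ltcR R) eE.
Qed.

Lemma rate_small (e : R[i]) : 0 < e -> \forall n \near \oo, rate n < e.
Proof.
move=> /gt0_RRe[eE re0].
near=> n.
have -> : rate n = (n.+1%:R^-1 : R)%:C%C by rewrite fmorphV rmorph_nat.
rewrite -eE ltcR.
near: n; exact: (near_infty_natSinv_lt (PosNum re0)).
Unshelve. all: by end_near. Qed.

Lemma rateM_small (C e : R[i]) : 0 <= C -> 0 < e -> \forall n \near \oo, C * rate n < e.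
Proof.
move=> C0 e0; have C1 : 0 < C + 1 by rewrite ltr_wpDl.
near=> n; apply: (@le_lt_trans _ _ ((C + 1) * rate n)).
  by rewrite ler_wpM2r ?rate_ge0// lerDl.
rewrite mulrC -ltr_pdivlMr//; near: n; apply: rate_small.
by rewrite divr_gt0.
Unshelve. all: by end_near. Qed.

Lemma rate_cvg V (u : nat -> V) (l : V) (C : R[i]) : 0 <= C ->
  (forall n, `|u n - l| <= C * rate n) -> u @ \oo --> l.
Proof.
move=> C0 h; apply/cvgrPdist_lt => e e0; near=> n.
rewrite distrC; apply: le_lt_trans (h n) _; near: n; exact: rateM_small.
Unshelve. all: by end_near. Qed.

Lemma lim_uniq V (u : nat -> V) (a b : V) : u @ \oo --> a -> u @ \oo --> b -> a = b.
Proof. exact: (@cvg_unique _ (@norm_hausdorff _ V)). Qed.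

(** In [R[i]] the order is partial, so closedness of the nonnegative cone is
    read off from [z = `|z|]. *)
Lemma ge0_lim (u : nat -> R[i]^o) (l : R[i]^o) : (forall n, 0 <= u n) ->
  u @ \oo --> l -> 0 <= l.
Proof.
move=> u0 /cvgrPdist_lt ul; rewrite ger0_def -subr_eq0 -normr_le0.
apply/ler_addgt0Pr => e e0; rewrite add0r.
have e2 : 0 < e / 2 by rewrite divr_gt0.
have [N _ /(_ N (leqnn N))/= /ltW h] := ul _ e2.
have -> : `|l| - l = (`|l| - `|u N|) + (u N - l) by rewrite (ger0_norm (u0 N)) addrA subrK.
rewrite (le_trans (ler_normD _ _))// (splitr e) lerD//; last by rewrite distrC.
by apply: le_trans h; exact: ler_dist_dist.
Qed.

Lemma norm_lim_le V (u : nat -> V) (l a : V) (M C : R[i]) : 0 <= C ->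
  (forall n, `|u n - a| <= M + C * rate n) ->
  u @ \oo --> l -> `|l - a| <= M.
Proof.
move=> C0 h ul; apply/ler_addgt0Pr => e e0.
have e2 : 0 < e / 2 by rewrite divr_gt0.
near \oo => n.
have -> : l - a = (l - u n) + (u n - a) by rewrite addrA subrK.
have -> : M + e = e / 2 + (M + e / 2) by rewrite addrCA -splitr.
rewrite (le_trans (ler_normD _ _))// lerD//.
  by apply: ltW; near: n; move/cvgrPdist_lt : ul; apply.
apply: (le_trans (h n)); rewrite lerD2l; apply: ltW; near: n; exact: rateM_small.
Unshelve. all: by end_near. Qed.

(** Real and imaginary parts are 1-Lipschitz, so completeness comes from [R]. *)
Let complex_complete (F : set_system R[i]^o) : ProperFilter F -> cauchy F -> cvg F.
Proof.
move=> FF Fc.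
have reF (p : R[i] -> R) : (forall x y, p (x - y) = p x - p y) ->
    (forall x, `|p x|%:C%C <= `|x|) -> cvg (p @ F).
  move=> pB pn; apply: cauchy_cvg; apply: cauchy_exP => e e0.
  have /cauchyP/(_ e%:C%C) := Fc.
  rewrite ltcR => /(_ e0)[x hx]; exists (p x).
  rewrite /= nbhs_filterE; apply: filterS hx => y.
  rewrite -!ball_normE/= => h; rewrite -(@ltcR R) -pB.
  exact: le_lt_trans (pn _) h.
have /cvg_ex[a ha] : cvg ((@complex.Re R) @ F).
  by apply: reF => [[? ?] [? ?]//|x]; exact: normc_ge_Re.
have /cvg_ex[b hb] : cvg ((@complex.Im R) @ F).
  apply: reF => [[? ?] [? ?]//|x].
  have := normc_ge_Re (x * 'i%C); rewrite ReiNIm normrN normrM.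
  suff -> : `|'i%C : R[i]| = 1 by rewrite mulr1.
  by rewrite normc_def/= expr0n/= add0r expr1n sqrtr1.
have dec (z : R[i]) :
    (a +i* b)%C - z = (a - complex.Re z)%:C%C + 'i%C * (b - complex.Im z)%:C%C.
  by case: z => x y; rewrite [LHS]complexE.
apply/cvg_ex; exists (a +i* b)%C; apply/cvgrPdist_lt => e e0.
have [eE re0] := gt0_RRe e0.
have e2 : 0 < complex.Re e / 2 by rewrite divr_gt0.
near=> z.
rewrite dec.
rewrite (le_lt_trans (ler_normD _ _))// normrM.
have -> : `|'i%C : R[i]| = 1 by rewrite normc_def/= expr0n/= add0r expr1n sqrtr1.
rewrite mul1r -eE.
have nr (x : R) : `|x%:C%C| = `|x|%:C%C :> R[i].
  by rewrite normc_def/= expr0n/= addr0 sqrtr_sqr.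
rewrite !nr -rmorphD ltcR (splitr (complex.Re e)) ltrD//; near: z.
  by move/cvgrPdist_lt : ha; apply.
by move/cvgrPdist_lt : hb; apply.
Unshelve. all: by end_near. Qed.

(** A packed structure rather than a canonical instance: [GRing.regular]
    already carries a completeness instance over [realType], and an instance
    for [R[i]^o] would have the same key. *)
Definition complexCN : completeNormedModType R[i] :=
  HB.pack R[i]^o (Uniform_isComplete.Build R[i]^o complex_complete).

Lemma rate_cauchy (W : completeNormedModType R[i]) (u : nat -> W) (C : R[i]) :
  0 <= C -> (forall n m, `|u n - u m| <= C * (rate n + rate m)) -> cvg (u @ \oo).
Proof.
move=> C0 h; apply: cauchy_cvg; apply: cauchy_exP => e e0.
have e2 : 0 < e / 2 by rewrite divr_gt0.
have [N _ hN] := rateM_small C0 e2.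
exists (u N); exists N => // n /= Nn; rewrite -ball_normE/=.
apply: le_lt_trans (h _ _) _; rewrite mulrDr (splitr e) ltrD//.
  exact: hN (leqnn _).
exact: hN.
Qed.

End ComplexLimits.

(** * Semi-inner products *)

Record semi_inner (R : realType) (V : lmodType R[i]) := SemiInner {
  sform :> V -> V -> R[i] ;
  sform_linear : forall a x y z, sform (a *: x + y) z = a * sform x z + sform y z ;
  sformC : forall x y, sform x y = (sform y x)^* ;
  sform_ge0 : forall x, 0 <= sform x x }.

Section SemiInner.
Variables (R : realType) (V : lmodType R[i]) (k : semi_inner V).
Implicit Types (x y z : V) (a : R[i]).

Lemma sform0l z : k 0 z = 0.
Proof.
have := sform_linear k 1 0 0 z; rewrite scaler0 addr0 mul1r => /eqP.
by rewrite -subr_eq subrr eq_sym => /eqP.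
Qed.
Lemma sformZl a x z : k (a *: x) z = a * k x z.
Proof. by rewrite -[a *: x]addr0 sform_linear sform0l addr0. Qed.
Lemma sformDl x y z : k (x + y) z = k x z + k y z.
Proof. by rewrite -[x]scale1r sform_linear mul1r scale1r. Qed.
Lemma sformBl x y z : k (x - y) z = k x z - k y z.
Proof. by rewrite sformDl -scaleN1r sformZl mulN1r. Qed.
Lemma sformZr a x z : k z (a *: x) = a^* * k z x.
Proof. by rewrite sformC sformZl rmorphM/= -sformC. Qed.
Lemma sformDr x y z : k z (x + y) = k z x + k z y.
Proof. by rewrite sformC sformDl rmorphD/= -!sformC. Qed.
Lemma sformBr x y z : k z (x - y) = k z x - k z y.
Proof. by rewrite sformC sformBl rmorphB/= -!sformC. Qed.

Definition snorm x := sqrtC (k x x).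

Lemma snorm_ge0 x : 0 <= snorm x.
Proof. by rewrite sqrtC_ge0 sform_ge0. Qed.

Lemma snormK x : snorm x ^+ 2 = k x x.
Proof. exact: sqrtCK. Qed.

Lemma snormZ a x : snorm (a *: x) = `|a| * snorm x.
Proof.
apply/eqP; rewrite -(@eqrXn2 _ 2%N) ?mulr_ge0 ?snorm_ge0//.
by rewrite snormK exprMn snormK sformZl sformZr mulrA normCK.
Qed.

Lemma snormN x : snorm (- x) = snorm x.
Proof. by rewrite -scaleN1r snormZ normrN1 mul1r. Qed.

Lemma snormBC x y : snorm (x - y) = snorm (y - x).
Proof. by rewrite -snormN opprB. Qed.

(** Expand the form at [x - (t * k x y) *: y] for real [t]. If [k y y] is
    nonzero, take [t] its inverse; if it is zero, the quadratic in [t] is affine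
    and nonnegative, so its slope vanishes. *)
Lemma snorm_cauchy_schwarz x y : `|k x y| <= snorm x * snorm y.
Proof.
have expand (t : R[i]) : t^* = t ->
    0 <= k x x - 2 * t * `|k x y| ^+ 2 + t ^+ 2 * `|k x y| ^+ 2 * k y y.
  move=> tr; have := sform_ge0 k (x - (t * k x y) *: y).
  rewrite !(sformBl, sformBr, sformZl, sformZr) rmorphM/= tr (sformC k y x) normCK.
  by congr (0 <= _); ring.
rewrite -(@ler_pXn2r _ 2%N)// ?nnegrE ?mulr_ge0 ?snorm_ge0//.
rewrite exprMn !snormK.
have [y0|y0] := eqVneq (k y y) 0.
  rewrite y0 mulr0; have [->|nz] := eqVneq (k x y) 0.
    by rewrite normr0 expr0n.
  have w0 : 0 < `|k x y| ^+ 2 by rewrite exprn_gt0// normr_gt0.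
  (* a value of t beyond the zero of the affine function *)
  have := expand ((k x x + 1) / `|k x y| ^+ 2).
  rewrite y0 mulr0 addr0 -mulrA divfK ?gt_eqF// => /(_ _).
  have h : ((k x x + 1) / `|k x y| ^+ 2)^* = (k x x + 1) / `|k x y| ^+ 2.
    by apply: CrealP; rewrite ger0_real// divr_ge0// ?addr_ge0 ?sform_ge0 ?exprn_ge0.
  move=> /(_ h).
  have -> : k x x - 2 * (k x x + 1) = - (k x x + 2) by ring.
  by rewrite oppr_ge0 => /le_gtF; rewrite ltr_wpDl ?sform_ge0.
have yp : 0 < k y y by rewrite lt_def y0 sform_ge0.
have := expand (k y y)^-1.
have h : ((k y y)^-1)^* = (k y y)^-1.
  by apply: CrealP; rewrite ger0_real// invr_ge0 sform_ge0.
move=> /(_ h).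
have -> : k x x - 2 * (k y y)^-1 * `|k x y| ^+ 2
    + (k y y)^-1 ^+ 2 * `|k x y| ^+ 2 * k y y = k x x - `|k x y| ^+ 2 / k y y.
  by field.
by rewrite subr_ge0 ler_pdivrMr.
Qed.

Lemma snormD x y : snorm (x + y) <= snorm x + snorm y.
Proof.
rewrite -(@ler_pXn2r _ 2%N)// ?nnegrE ?addr_ge0 ?snorm_ge0//.
rewrite sqrrD !snormK sformDl !sformDr.
have -> : k x x + k x y + (k y x + k y y) = k x x + (k x y + k y x) + k y y by ring.
rewrite lerD2r lerD2l (sformC k y x).
have re : (k x y + (k x y)^*) \is Num.real.
  by apply/CrealP; rewrite rmorphD/= conjCK addrC.
rewrite (le_trans (real_ler_norm re))// (le_trans (ler_normD _ _))// norm_conjC.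
by rewrite mulr2n lerD// snorm_cauchy_schwarz.
Qed.

Lemma snorm_dist x y z : snorm (x - z) <= snorm (x - y) + snorm (y - z).
Proof. by rewrite -{1}(subrK y x) -addrA snormD. Qed.

End SemiInner.

(** * Hilbert space completion

    The completion is realised inside the functions on [V]: a vector is the
    functional [x |-> k z x] of a virtual [z], that is, a limit in the dual norm
    of functionals [k (b n)] with [b n] in [V]. Equality of vectors is then
    equality of functions and no quotient is needed, although [k] may be
    degenerate. *)

Section Completion.
Variables (R : realType) (V : lmodType R[i]) (k : semi_inner V).
Implicit Types (x y z : V) (a : R[i]) (f g : V -> R[i]^o) (b c : nat -> V).
Local Notation sn := (snorm k).

Definition represents f b := exists2 C : R[i], 0 <= C &
  forall n x, `|f x - k (b n) x| <= C * rate R n * sn x.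

Lemma represents_linear a f g b c : represents f b -> represents g c ->
  represents (a *: f + g) (fun n => a *: b n + c n).
Proof.
move=> [C C0 fb] [D D0 gc]; exists (`|a| * C + D) => [|n x].
  by rewrite addr_ge0// mulr_ge0.
rewrite sform_linear.
have -> : (a *: f + g) x - (a * k (b n) x + k (c n) x) =
  a * (f x - k (b n) x) + (g x - k (c n) x).
  by rewrite -[(a *: f + g) x]/(a * f x + g x); ring.
rewrite (le_trans (ler_normD _ _))// normrM.
have -> : (`|a| * C + D) * rate R n * sn x =
  `|a| * (C * rate R n * sn x) + D * rate R n * sn x by ring.
by rewrite lerD// ler_wpM2l.
Qed.

Definition in_completion : {pred V -> R[i]^o} :=
  fun f => `[< exists b, represents f b >].

Lemma in_completion_submod : submod_closed in_completion.
Proof.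
split=> [|a f g].
  apply/asboolP; exists (fun _ => 0); exists 0 => // n x.
  by rewrite sform0l subr0 normr0 !mul0r.
move=> /asboolP[b fb] /asboolP[c gc]; apply/asboolP.
by exists (fun n => a *: b n + c n); exact: represents_linear.
Qed.

HB.instance Definition _ :=
  GRing.isSubmodClosed.Build R[i] (V -> R[i]^o) in_completion in_completion_submod.

Record completion := Completion {
  cval :> V -> R[i]^o ;
  cvalP : cval \in in_completion }.

HB.instance Definition _ := [isSub for cval].
HB.instance Definition _ := [Choice of completion by <:].
HB.instance Definition _ := [SubChoice_isSubLmodule of completion by <:].

(** Take [x = y]: the seminorm is bounded by the dual norm of [k y]. *)
Lemma snorm_le y (A : R[i]) : 0 <= A -> (forall x, `|k y x| <= A * sn x) -> sn y <= A.
Proof.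
move=> A0 h; have [->//|y0] := eqVneq (sn y) 0.
have yp : 0 < sn y by rewrite lt_def y0 snorm_ge0.
rewrite -(ler_pM2r yp) -expr2 snormK -(ger0_norm (sform_ge0 k y)); exact: h.
Qed.

Lemma represents_dist f b b' : represents f b -> represents f b' ->
  exists2 C : R[i], 0 <= C & forall n m, sn (b n - b' m) <= C * (rate R n + rate R m).
Proof.
move=> [C C0 fb] [D D0 fb']; exists (C + D); first by rewrite addr_ge0.
move=> n m; have rn := rate_ge0 R n; have rm := rate_ge0 R m.
apply: snorm_le => [|x]; first by rewrite mulr_ge0// addr_ge0.
rewrite sformBl; have -> : k (b n) x - k (b' m) x =
  (f x - k (b' m) x) - (f x - k (b n) x) by ring.
rewrite (le_trans (ler_normB _ _))// (le_trans (lerD (fb' m x) (fb n x)))//.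
rewrite -mulrDl ler_wpM2r ?snorm_ge0//.
have -> : (C + D) * (rate R n + rate R m) =
  (D * rate R m + C * rate R n) + (C * rate R m + D * rate R n) by ring.
by rewrite lerDl addr_ge0// mulr_ge0.
Qed.

Lemma rate_le1 n : rate R n <= 1.
Proof. by have := @rate_le R 0 n (leq0n _); rewrite {2}/rate invr1. Qed.

Lemma represents_bounded f b : represents f b -> exists2 C : R[i], 0 <= C & forall n, sn (b n) <= C.
Proof.
move=> fb; have [C C0 h] := represents_dist fb fb; exists (sn (b 0) + C * 2).
  by rewrite addr_ge0 ?snorm_ge0// mulr_ge0.
move=> n; rewrite -[b n](subrK (b 0)) addrC (le_trans (snormD _ _ _))// lerD2l.
by rewrite (le_trans (h _ _))// ler_wpM2l// [leRHS]mulr2n lerD// rate_le1.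
Qed.

(** With [b = b'] and [c = c'] this makes [k (b n) (c n)] converge; with [n = m]
    it makes the limit independent of the representing sequences. *)
Lemma represents_cauchy f g b b' c c' :
  represents f b -> represents f b' -> represents g c -> represents g c' ->
  exists2 C : R[i], 0 <= C & forall n m,
    `|k (b n) (c n) - k (b' m) (c' m)| <= C * (rate R n + rate R m).
Proof.
move=> fb fb' gc gc'.
have [C C0 hb] := represents_dist fb fb'; have [D D0 hc] := represents_dist gc gc'.
have [E E0 bb] := represents_bounded fb'; have [F F0 cc] := represents_bounded gc.
exists (C * F + E * D); first by rewrite addr_ge0// mulr_ge0.
move=> n m; set r := rate R n + rate R m.
have -> : k (b n) (c n) - k (b' m) (c' m) =
  k (b n - b' m) (c n) + k (b' m) (c n - c' m).
  by rewrite sformBl sformBr; ring.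
rewrite (le_trans (ler_normD _ _))//.
have -> : (C * F + E * D) * r = C * r * F + E * (D * r) by ring.
by rewrite lerD// (le_trans (snorm_cauchy_schwarz _ _ _))// ler_pM// ?snorm_ge0.
Qed.

Lemma completion_fast (f : completion) : exists b, represents f b.
Proof. by have /asboolP := cvalP f. Qed.

Lemma cip_ex (f g : completion) : exists l : R[i]^o, forall b c,
  represents f b -> represents g c -> (fun n => k (b n) (c n) : R[i]^o) @ \oo --> l.
Proof.
have [b fb] := completion_fast f; have [c gc] := completion_fast g.
have [C C0 h] := represents_cauchy fb fb gc gc.
have /cvg_ex[l hl] := @rate_cauchy R (complexCN R) (fun n => k (b n) (c n)) C C0 h.
exists l => b' c' fb' gc'.
have [D D0 h'] := represents_cauchy fb' fb gc' gc.
have z : (fun n => k (b' n) (c' n) - k (b n) (c n) : R[i]^o) @ \oo --> (0 : R[i]^o).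
  apply: (@rate_cvg _ _ _ _ (D * 2)) => [|n]; first by rewrite mulr_ge0.
  have -> : D * 2 * rate R n = D * (rate R n + rate R n) by ring.
  by rewrite subr0; exact: h'.
have E : (fun n => k (b' n) (c' n) : R[i]^o) =
    (fun n => (k (b' n) (c' n) - k (b n) (c n) : R[i]^o) + (k (b n) (c n) : R[i]^o)).
  by apply/funext => n; rewrite subrK.
rewrite E -[l]add0r; exact: (cvgD z hl).
Qed.

Definition cip (f g : completion) : R[i] := projT1 (cid (cip_ex f g)).

Lemma cip_cvg (f g : completion) b c : represents f b -> represents g c ->
  (fun n => k (b n) (c n) : R[i]^o) @ \oo --> (cip f g : R[i]^o).
Proof. by rewrite /cip; case: cid => l h; apply: h. Qed.

Lemma cvg_lincomb a (u v : nat -> R[i]^o) (l m : R[i]^o) :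
  u @ \oo --> l -> v @ \oo --> m ->
  (fun n => a * u n + v n : R[i]^o) @ \oo --> (a * l + m : R[i]^o).
Proof. by move=> ul vm; apply: (cvgD _ vm); apply: cvgZl_tmp; exact: ul. Qed.

Lemma cvg_conj (u : nat -> R[i]^o) (l : R[i]^o) :
  u @ \oo --> l -> (fun n => (u n)^* : R[i]^o) @ \oo --> (l^* : R[i]^o).
Proof.
move=> /cvgrPdist_lt h; apply/cvgrPdist_lt => e /h; apply: filterS => n.
by rewrite -rmorphB norm_conjC.
Qed.

Lemma cip_linear a (f g h : completion) : cip (a *: f + g) h = a * cip f h + cip g h.
Proof.
have [b fb] := completion_fast f; have [c gc] := completion_fast g.
have [d hd] := completion_fast h.
have := cvg_lincomb (a := a) (cip_cvg fb hd) (cip_cvg gc hd).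
have := @cip_cvg (a *: f + g) h _ _ (represents_linear a fb gc) hd.
rewrite (_ : (fun n => k (a *: b n + c n) (d n) : R[i]^o) =
  fun n => a * k (b n) (d n) + k (c n) (d n)); first exact: lim_uniq.
by apply/funext => n; rewrite sform_linear.
Qed.

Lemma cipC (f g : completion) : cip f g = (cip g f)^*.
Proof.
have [b fb] := completion_fast f; have [c gc] := completion_fast g.
have := cvg_conj (cip_cvg gc fb); have := cip_cvg fb gc.
rewrite (_ : (fun n => k (b n) (c n) : R[i]^o) =
  fun n => (k (c n) (b n))^*); first exact: lim_uniq.
by apply/funext => n; rewrite sformC.
Qed.

Lemma cip_ge0 (f : completion) : 0 <= cip f f.
Proof.
have [b fb] := completion_fast f.
by apply: ge0_lim (cip_cvg fb fb) => n; exact: sform_ge0.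
Qed.

Definition completion_form := SemiInner cip_linear cipC cip_ge0.

Lemma represents_emb x : represents (k x) (fun _ => x).
Proof. by exists 0 => // n y; rewrite subrr normr0 !mul0r. Qed.

Lemma emb_subproof x : (k x : V -> R[i]^o) \in in_completion.
Proof. by apply/asboolP; exists (fun _ => x); exact: represents_emb. Qed.

Definition emb x : completion := Completion (emb_subproof x).

Lemma emb_linear : linear emb.
Proof.
move=> a x y; apply: val_inj; apply/funext => z /=.
by rewrite sform_linear.
Qed.

Lemma cip_emb (f : completion) x : cip f (emb x) = f x.
Proof.
have [b fb] := completion_fast f.
have := @cip_cvg f (emb x) _ _ fb (represents_emb x).
move=> lim1; have [C C0 h] := fb; apply: (@lim_uniq R R[i]^o _ _ _ lim1).
apply: (@rate_cvg _ _ _ _ (C * sn x)) => [|n]; first by rewrite mulr_ge0 ?snorm_ge0.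
by rewrite distrC mulrAC; exact: h.
Qed.

Local Notation csn := (snorm completion_form).

Lemma csn_eq0 (f : completion) : csn f = 0 -> f = 0.
Proof.
move=> f0; apply: val_inj; apply/funext => x.
have := snorm_cauchy_schwarz completion_form f (emb x).
by rewrite f0 mul0r /= cip_emb normr_le0 => /eqP.
Qed.

Lemma csn_emb x : csn (emb x) = sn x.
Proof. by rewrite /snorm /= cip_emb. Qed.

(** The sequence [m |-> b m - b n] represents [f - emb (b n)], so the square of
    the distance is the limit of [k (b m - b n) (b m - b n)]. *)
Lemma represents_approx (f : completion) b : represents f b -> exists2 C : R[i], 0 <= C &
  forall n, csn (f - emb (b n)) <= C * rate R n.
Proof.
move=> fb; have [C C0 h] := represents_dist fb fb; exists C => // n.
have fd : represents (f - emb (b n)) (fun m => b m - b n).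
  have := represents_linear (-1) (represents_emb (b n)) fb.
  rewrite scaleN1r addrC; congr (represents _ _).
  by apply/funext => m; rewrite scaleN1r addrC.
have rn := rate_ge0 R n.
rewrite -(@ler_pXn2r _ 2%N)// ?nnegrE ?mulr_ge0 ?snorm_ge0//.
rewrite snormK /= -(ger0_norm (cip_ge0 _)) -[X in `|X|]subr0.
apply: norm_lim_le (cip_cvg fd fd) => [|m]; last first.
  rewrite subr0 -snormK ger0_norm ?exprn_ge0 ?snorm_ge0//.
  have rm := rate_ge0 R m.
  apply: (@le_trans _ _ ((C * (rate R n + rate R m)) ^+ 2)).
    rewrite ler_pXn2r ?nnegrE ?snorm_ge0 ?mulr_ge0 ?addr_ge0// snormBC; exact: h.
  have -> : (C * (rate R n + rate R m)) ^+ 2 = (C * rate R n) ^+ 2 +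
     (C ^+ 2 * (2 * rate R n + rate R m)) * rate R m by ring.
  rewrite lerD2l ler_wpM2r//; apply: (@le_trans _ _ (C ^+ 2 * 3)); last by [].
  rewrite ler_wpM2l ?exprn_ge0// (natrD _ 2 1) lerD ?rate_le1// ler_piMr ?rate_le1//.
by rewrite mulr_ge0// exprn_ge0.
Qed.

HB.instance Definition _ := Lmodule_isNormed.Build R[i] completion
  (@snormD _ _ completion_form) (@snormZ _ _ completion_form) csn_eq0.

Lemma csnE (f : completion) : `|f| = csn f. Proof. by []. Qed.

(** Along a Cauchy filter pick balls of radius [rate n] with centres [f n], and
    [b n] in [V] within [rate n] of [f n]: the pointwise limit of the
    functionals [k (b n)] is the limit of the filter. *)
Let complete_completion (F : set_system completion) :
  ProperFilter F -> cauchy F -> cvg F.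
Proof.
move=> FF /cauchyP Fc.
have /choice[f hf] : forall n, exists f : completion, F (ball f (rate R n)).
  by move=> n; exact: Fc (rate_gt0 R n).
have /choice[b hb] : forall n, exists x, csn (f n - emb x) <= rate R n.
  move=> n; have [b fb] := completion_fast (f n).
  have [C C0 h] := represents_approx fb.
  have [N _ hN] := rateM_small C0 (rate_gt0 R n).
  by exists (b N); rewrite (le_trans (h N))//; exact/ltW/hN/leqnn.
have ff n m : csn (f n - f m) <= rate R n + rate R m.
  have [g []] := filter_ex (filterI (hf n) (hf m)).
  rewrite -!ball_normE/= !csnE => h1 h2.
  by rewrite (le_trans (snorm_dist _ _ g _))// lerD ?ltW// snormBC.
have bb n m : sn (b n - b m) <= 2 * (rate R n + rate R m).
  rewrite -csn_emb (linear_morphB emb_linear).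
  rewrite (le_trans (snorm_dist _ _ (f n) _))//.
  have -> : 2 * (rate R n + rate R m) =
    rate R n + (rate R n + rate R m + rate R m) by ring.
  rewrite lerD//; first by rewrite snormBC.
  by rewrite (le_trans (snorm_dist _ _ (f m) _))// lerD.
have bnd x n m : `|k (b n) x - k (b m) x| <= (2 * sn x) * (rate R n + rate R m).
  rewrite -sformBl (le_trans (snorm_cauchy_schwarz _ _ _))// mulrAC.
  by rewrite ler_wpM2r ?snorm_ge0.
have /choice[g hg] x : exists l : R[i]^o, (fun n => k (b n) x : R[i]^o) @ \oo --> l.
  apply/cvg_ex; apply: (@rate_cauchy R (complexCN R) _ (2 * sn x)) => [|n m].
    by rewrite mulr_ge0 ?snorm_ge0.
  exact: bnd.
have gb : represents g b.
  exists 2 => // n x; apply: (@norm_lim_le _ _ _ _ _ _ (2 * sn x)) (hg x) => [|m].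
    by rewrite mulr_ge0 ?snorm_ge0.
  rewrite (le_trans (bnd _ _ _))// mulrDr addrC mulrAC; exact: lexx.
have gin : g \in in_completion by apply/asboolP; exists b.
pose G : completion := Completion gin.
have [C C0 hG] := @represents_approx G b gb.
apply/cvg_ex; exists G; apply/cvgrPdist_lt => e e0.
have [N _ hN] := rateM_small (addr_ge0 C0 (ler0n _ 2)) e0.
apply: filterS (hf N) => h; rewrite -ball_normE/= => hh.
apply: le_lt_trans (hN N (leqnn N)); rewrite !csnE.
rewrite (le_trans (snorm_dist _ _ (emb (b N)) _))// mulrDl lerD//.
rewrite (le_trans (snorm_dist _ _ (f N) _))// (_ : 2 * _ = rate R N + rate R N); last by ring.
by rewrite lerD//; [rewrite snormBC|rewrite ltW].
Qed.

HB.instance Definition _ := Uniform_isComplete.Build completion complete_completion.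

Let cip_bilinear : bilinear_for
  (GRing.Scale.Law.clone _ _ *%R _) (GRing.Scale.Law.clone _ _ (Num.conj \; *%R) _) cip.
Proof.
split=> f a g h; first exact: cip_linear.
by rewrite cipC cip_linear rmorphD rmorphM/= -!cipC.
Qed.

HB.instance Definition _ := bilinear_isBilinear.Build
  R[i] completion completion R[i] _ _ cip cip_bilinear.

Let cip_hermitian (f g : completion) : cip f g = (-1) ^+ false * Num.conj (cip g f).
Proof. by rewrite expr0 mul1r cipC. Qed.

HB.instance Definition _ := isHermitianSesquilinear.Build
  R[i] completion false Num.conj cip cip_hermitian.

Let cip_gt0 (f : completion) : f != 0 -> 0 < cip f f.
Proof.
move=> f0; rewrite lt_def cip_ge0 andbT; apply: contra f0 => /eqP ff0.
by apply/eqP/csn_eq0; rewrite /snorm /= ff0 sqrtC0.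
Qed.

HB.instance Definition _ := isDotProduct.Build R[i] completion cip cip_gt0.

Let completion_norm (f : completion) : `|f| ^+ 2 = cip f f.
Proof. exact: snormK completion_form f. Qed.

Definition completion_hilbert : hilbert R := @Hilbert R completion cip completion_norm.

End Completion.

Definition dense_map (R : realType) (V : Type) (L : normedModType R[i]) (j : V -> L) :=
  forall z (e : R[i]), 0 < e -> exists x, `|z - j x| < e.

Lemma hilbert_completion (R : realType) (V : lmodType R[i]) (k : semi_inner V) :
  exists (L : hilbert R) (j : V -> L), [/\ linear j,
    forall x y, inner L (j x) (j y) = k x y & dense_map j].
Proof.
exists (completion_hilbert k), (@emb _ _ k); split; first exact: emb_linear.
  by move=> x y; exact: cip_emb.
move=> z e e0; have [b fb] := completion_fast z.
have [C C0 h] := represents_approx fb.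
have [N _ hN] := rateM_small C0 e0; exists (b N).
by apply: le_lt_trans (h N) _; exact: hN (leqnn _).
Qed.

(** * Extension by density and operators from forms *)

Lemma dense_seq (R : realType) (V : Type) (L : normedModType R[i]) (j : V -> L) (z : L) :
  dense_map j -> exists b : nat -> V, forall n, `|z - j (b n)| <= rate R n.
Proof.
move=> dj; suff /choice[b hb] : forall n, exists x, `|z - j x| <= rate R n by exists b.
by move=> n; have [x h] := dj z _ (rate_gt0 R n); exists x; exact: ltW.
Qed.

Section Extension.
Variables (R : realType) (V : lmodType R[i]) (L : normedModType R[i]).
Variables (W : completeNormedModType R[i]) (j : V -> L) (g : V -> W) (M : R[i]).
Hypotheses (jlin : linear j) (jdense : dense_map j) (glin : linear g).
Hypotheses (M0 : 0 <= M) (gM : forall x, `|g x| <= M * `|j x|).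

Let approx (z : L) (b : nat -> V) := exists2 C : R[i], 0 <= C &
  forall n, `|z - j (b n)| <= C * rate R n.

(** The value at [z] of the extension, as the common limit of [g] along all
    sequences approaching [z] at some rate. *)
Let ext_ex z : exists w : W, forall b, approx z b -> (g \o b) @ \oo --> w.
Proof.
have key b c : approx z b -> approx z c -> exists2 C : R[i], 0 <= C &
    forall n m, `|g (b n) - g (c m)| <= C * (rate R n + rate R m).
  move=> [C C0 bz] [D D0 cz]; exists (M * (C + D)); first by rewrite mulr_ge0// addr_ge0.
  move=> n m; have rn := rate_ge0 R n; have rm := rate_ge0 R m.
  rewrite -(linear_morphB glin) (le_trans (gM _))// -mulrA ler_wpM2l//.
  rewrite (linear_morphB jlin) (_ : _ - _ = (z - j (c m)) - (z - j (b n))); last first.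
    by rewrite opprB [RHS]addrC addrA subrK.
  rewrite (le_trans (ler_normB _ _))// (le_trans (lerD (cz m) (bz n)))//.
  have -> : (C + D) * (rate R n + rate R m) =
    (D * rate R m + C * rate R n) + (C * rate R m + D * rate R n) by ring.
  by rewrite lerDl addr_ge0// mulr_ge0.
have [b0 hb0] := dense_seq z jdense.
have b0z : approx z b0 by exists 1 => // n; rewrite mul1r.
have [C C0 h] := key _ _ b0z b0z.
have /cvg_ex[w hw] := @rate_cauchy R W (g \o b0) C C0 h.
exists w => b bz; have [D D0 h'] := key _ _ bz b0z.
have E : g \o b = (fun n => (g (b n) - g (b0 n)) + g (b0 n)).
  by apply/funext => n; rewrite subrK.
rewrite E -[w]add0r; apply: cvgD => //.
apply: (@rate_cvg _ _ _ _ (D * 2)) => [|n]; first by rewrite mulr_ge0.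
have -> : D * 2 * rate R n = D * (rate R n + rate R n) by ring.
by rewrite subr0; exact: h'.
Qed.

(** Since [`|g x| <= M * `|j x|], the map [g] is constant on the fibres of [j]
    and Cauchy along sequences converging in [L]; [j] need not be injective. *)
Lemma extend_bounded : exists G : L -> W,
  [/\ linear G, forall x, G (j x) = g x & forall z, `|G z| <= M * `|z|].
Proof.
have /choice[G hG] := ext_ex; exists G.
have seq z : exists2 b, approx z b & forall n, `|z - j (b n)| <= rate R n.
  have [b hb] := dense_seq z jdense; exists b => //.
  by exists 1 => // n; rewrite mul1r.
split.
- move=> a z w; have [b [C C0 bz] _] := seq z; have [c [D D0 cw] _] := seq w.
  have h : approx (a *: z + w) (fun n => a *: b n + c n).
    exists (`|a| * C + D) => [|n]; first by rewrite addr_ge0// mulr_ge0.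
    rewrite jlin opprD addrACA -scalerBr (le_trans (ler_normD _ _))// mulrDl lerD//.
    by rewrite normrZ -mulrA ler_wpM2l.
  have := hG _ _ h.
  have -> : g \o (fun n => a *: b n + c n) = (fun n => a *: g (b n) + g (c n)).
    by apply/funext => n; rewrite /= glin.
  move=> h1; apply: (lim_uniq h1); apply: cvgD; last by apply: hG; exists D.
  by apply: cvgZl_tmp; apply: hG; exists C.
- move=> x; apply: (@lim_uniq _ W (fun _ => g x)); last exact: cvg_cst.
  by apply: (hG _ (fun _ => x)); exists 0 => // n; rewrite subrr normr0 mul0r.
- move=> z; have [b bz hb] := seq z.
  rewrite -[G z]subr0; apply: (norm_lim_le M0) (hG _ _ bz) => n /=.
  rewrite subr0 (le_trans (gM _))// -mulrDr ler_wpM2l//.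
  rewrite -[j (b n)](subrK z) addrC (le_trans (ler_normD _ _))// lerD2l distrC.
  exact: hb.
Qed.

End Extension.

Section HilbertTools.
Variables (R : realType) (L : hilbert R).

Lemma bounded_bop (T : L -> L) (M : R[i]) : linear T -> 0 <= M ->
  (forall x, `|T x| <= M * `|x|) -> exists X : bop L, forall x, X x = T x.
Proof.
move=> Tlin M0 hT.
pose T' := GRing.isLinear.Build _ _ _ _ _ Tlin.
pose G : {linear L -> L} := HB.pack T T'.
suff cG : continuous G by exists (Bop Tlin cG).
apply: (@bounded_linear_continuous _ _ _ G); apply/linear_boundedP.
exists M; split; first exact: ger0_real.
move=> r Mr x /=; rewrite (le_trans (hT x))// ler_wpM2r//; exact: ltW.
Qed.

Lemma riesz_bounded (g : L -> R[i]) (M : R[i]) :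
  (forall a x y, g (a *: x + y) = a * g x + g y) -> 0 <= M ->
  (forall x, `|g x| <= M * `|x|) -> exists z, forall x, g x = inner L x z.
Proof.
move=> glin M0 hg.
have gl : linear (g : L -> R[i]^o) by move=> a x y; rewrite glin.
pose g' := GRing.isLinear.Build _ _ _ _ _ gl.
pose G : {linear L -> R[i]^o} := HB.pack (g : L -> R[i]^o) g'.
apply: (@riesz _ _ G).
apply: (@bounded_linear_continuous _ _ _ G); apply/linear_boundedP.
exists M; split; first exact: ger0_real.
move=> r Mr x /=; rewrite (le_trans (hg x))// ler_wpM2r//; exact: ltW.
Qed.

Lemma inner_cvg (u v : nat -> L) (x y : L) : u @ \oo --> x -> v @ \oo --> y ->
  (fun n => inner L (u n) (v n) : R[i]^o) @ \oo --> (inner L x y : R[i]^o).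
Proof.
move=> ux vy.
have E : (fun n => inner L (u n) (v n) : R[i]^o) =
  (fun n => (inner L (u n) (v n - y) : R[i]^o) + (inner L (u n) y : R[i]^o)).
  by apply/funext => n; rewrite -innerDr subrK.
rewrite E -[inner L x y]add0r; apply: cvgD; last first.
  exact: cvg_comp ux (@inner_continuousl _ _ y x).
have [C C0 bC] : exists2 C : R[i], 0 < C & \forall n \near \oo, `|u n| <= C.
  exists (`|x| + 1); first by rewrite ltr_wpDl.
  move/cvgrPdist_lt : ux => /(_ 1 ltr01); apply: filterS => n h.
  rewrite -[u n](subrK x) addrC (le_trans (ler_normD _ _))// lerD2l distrC.
  exact: ltW.
apply/cvgr0Pnorm_lt => e e0.
have eC : 0 < e / C by rewrite divr_gt0.
near=> n.
apply: le_lt_trans (cauchy_schwarz _ _) _.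
apply: (@le_lt_trans _ _ (C * `|v n - y|)).
  by rewrite ler_wpM2r//; near: n.
rewrite mulrC -ltr_pdivlMr// distrC; near: n.
by move/cvgrPdist_lt : vy; apply.
Unshelve. all: by end_near. Qed.

Lemma inner_cvgr (v : nat -> L) (x y : L) : v @ \oo --> y ->
  (fun n => inner L x (v n) : R[i]^o) @ \oo --> (inner L x y : R[i]^o).
Proof. exact: inner_cvg (cvg_cst _). Qed.

Lemma dense_cvg (V : Type) (j : V -> L) (z : L) : dense_map j ->
  exists b : nat -> V, (fun n => j (b n) : L) @ \oo --> z.
Proof.
move=> /(dense_seq z)[b hb]; exists b; apply: (@rate_cvg _ _ _ _ 1) => // n.
by rewrite mul1r distrC.
Qed.

Lemma dense_separates (V : Type) (j : V -> L) (z : L) : dense_map j ->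
  (forall x, inner L (j x) z = 0) -> z = 0.
Proof.
move=> /(dense_cvg z)[b hb] h; apply/eqP; rewrite -normr_eq0 -sqrf_eq0 sqr_normE.
have h1 : (fun n => inner L (j (b n)) z : R[i]^o) @ \oo --> (inner L z z : R[i]^o).
  exact: inner_cvg hb (cvg_cst _).
apply/eqP; apply: (@lim_uniq R R[i]^o _ _ _ h1).
by rewrite (_ : (fun _ => _) = (fun _ => 0)); [exact: cvg_cst|apply/funext => n].
Qed.

(** For fixed [x], the functional [y |-> (B x y)^*] extends to [L] and is
    represented there by a vector [g x] by Riesz; the linear map [g] is
    bounded, so it extends to [L] in turn. *)
Lemma form_operator (V : lmodType R[i]) (j : V -> L) (B : V -> V -> R[i]) (M : R[i]) :
  linear j -> dense_map j ->
  (forall a x y z, B (a *: x + y) z = a * B x z + B y z) ->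
  (forall a x y z, B z (a *: x + y) = a^* * B z x + B z y) ->
  0 <= M -> (forall x y, `|B x y| <= M * `|j x| * `|j y|) ->
  exists X : bop L, forall x y, inner L (X (j x)) (j y) = B x y.
Proof.
move=> jlin jd Bl Br M0 BM.
have /choice[g gP] x : exists w : L, (forall y, inner L w (j y) = B x y) /\ `|w| <= M * `|j x|.
  have h0 : 0 <= M * `|j x| by rewrite mulr_ge0.
  have hl : linear (fun y => (B x y)^* : R[i]^o).
    by move=> a y z; rewrite Br rmorphD rmorphM/= conjCK.
  have hb y : `|(B x y)^* : R[i]^o| <= M * `|j x| * `|j y|.
    by rewrite (_ : `|_| = `|B x y|) ?norm_conjC.
  have [G [Gl Gj GM]] := @extend_bounded R V L (complexCN R) j _ _ jlin jd hl h0 hb.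
  have [w hw] := riesz_bounded Gl h0 GM.
  exists w; split=> [y|].
    by rewrite innerC -hw Gj conjCK.
  have [->|w0] := eqVneq w 0; first by rewrite normr0.
  have wp : 0 < `|w| by rewrite normr_gt0.
  rewrite -(ler_pM2r wp) -expr2 sqr_normE -hw.
  have -> : G w = `|G w : R[i]^o| by rewrite ger0_norm// hw -sqr_normE exprn_ge0.
  exact: GM.
have glin : linear g.
  move=> a x y; apply/eqP; rewrite -subr_eq0; apply/eqP.
  apply: (dense_separates jd) => z; rewrite innerC.
  by rewrite innerBl innerDl innerZl !(gP _).1 Bl subrr conjC0.
have [G [Gl Gj GM]] := extend_bounded jlin jd glin M0 (fun x => (gP x).2).
have [X hX] := bounded_bop Gl M0 GM.
by exists X => x y; rewrite hX Gj (gP x).1.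
Qed.

End HilbertTools.

(** * Closed subspaces and orthogonal projections *)

Section SubspaceType.
Variables (C : numFieldType) (V : lmodType C) (E : set V).
Hypothesis (hE : linear_subspace E).

(** The proof argument is a phantom: it lets the module structure of the
    subtype be inferred from the type alone. *)
Definition subspace_pred (_ : linear_subspace E) : {pred V} := fun x => `[< E x >].

Let subspace_submod : submod_closed (subspace_pred hE).
Proof.
case: hE => E0 EP; split; first exact/asboolP.
by move=> a x y /asboolP Ex /asboolP Ey; apply/asboolP; exact: EP.
Qed.

HB.instance Definition _ :=
  GRing.isSubmodClosed.Build C V (subspace_pred hE) subspace_submod.

Record subspace_type := InSubspace {
  subspace_val :> V ;
  subspace_valP : subspace_val \in subspace_pred hE }.

HB.instance Definition _ := [isSub for subspace_val].
HB.instance Definition _ := [Choice of subspace_type by <:].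
HB.instance Definition _ := [SubChoice_isSubLmodule of subspace_type by <:].

Lemma in_subspace x : E x -> exists u : subspace_type, subspace_val u = x.
Proof. by move=> /asboolP Ex; exists (InSubspace Ex). Qed.

Lemma subspaceP (u : subspace_type) : E (subspace_val u).
Proof. by have /asboolP := subspace_valP u. Qed.

Lemma subspace_val_linear : linear subspace_val.
Proof. by []. Qed.

End SubspaceType.

Section Projection.
Variables (R : realType) (L : hilbert R).

Lemma inner_norm (L1 L2 : hilbert R) (x : L1) (y : L2) :
  inner L1 x x = inner L2 y y -> `|x| = `|y|.
Proof. by rewrite -!sqr_normE => /eqP; rewrite eqrXn2// => /eqP. Qed.

(** Complete the subspace [E] to a Hilbert space [L'], where Riesz gives a
    vector [y] representing [z |-> <z, xi>]. Elements of [E] that converge to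
    [y] in [L'] form a Cauchy sequence of [L], whose limit is in [E] because
    [E] is closed. *)
Lemma projection (E : set L) (xi : L) : linear_subspace E -> closed E ->
  exists2 v, E v & forall z, E z -> inner L z (xi - v) = 0.
Proof.
move=> hE cE.
pose V := subspace_type hE.
have k1 a (x y z : V) : inner L (a *: x + y : V) z = a * inner L x z + inner L y z.
  by rewrite [subspace_val _]subspace_val_linear innerDl innerZl.
have k2 (x y : V) : inner L x y = (inner L y x)^* by exact: innerC.
have k3 (x : V) : 0 <= inner L x x by rewrite -sqr_normE exprn_ge0.
pose k : semi_inner V := SemiInner k1 k2 k3.
have [L' [j [jlin jk jd]]] := hilbert_completion k.
have jn (x : V) : `|j x| = `|subspace_val x| by apply: inner_norm; rewrite jk.
have gl : linear (fun x : V => inner L x xi : R[i]^o).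
  by move=> a x y; rewrite [subspace_val _]subspace_val_linear innerDl innerZl.
have gb (x : V) : `|inner L x xi : R[i]^o| <= `|xi| * `|j x|.
  by rewrite jn mulrC; exact: cauchy_schwarz.
have [G [Gl Gj GM]] := @extend_bounded R V L' (complexCN R) j _ _ jlin jd gl (normr_ge0 _) gb.
have [y hy] := riesz_bounded Gl (normr_ge0 xi) GM.
have [b hb] := dense_seq y jd.
have /cvg_ex[v hv] : cvg ((fun n => subspace_val (b n)) @ \oo).
  apply: (@rate_cauchy R L _ 1) => // n m.
  have -> : `|subspace_val (b n) - subspace_val (b m)| = `|j (b n) - j (b m)|.
    by rewrite -(linear_morphB jlin) jn.
  rewrite mul1r -[j (b n)](subrK y) -addrA (le_trans (ler_normD _ _))// lerD//.
  by rewrite distrC.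
have jy : (fun n => j (b n)) @ \oo --> y.
  by apply: (@rate_cvg _ _ _ _ 1) => // n; rewrite mul1r distrC.
exists v.
  by apply: (@closed_cvg _ L _ _ _ E cE _ _ hv); near=> n; exact: subspaceP.
move=> z /(in_subspace hE)[x <-]; rewrite innerBr.
have -> : inner L x xi = inner L' (j x) y by rewrite -hy Gj.
have h1 := @inner_cvgr _ _ _ (j x) _ jy.
have h2 := @inner_cvgr _ _ _ (subspace_val x) _ hv.
have E12 : (fun n => inner L' (j x) (j (b n)) : R[i]^o) =
    (fun n => inner L (subspace_val x) (subspace_val (b n)) : R[i]^o).
  by apply/funext => n; rewrite jk.
rewrite E12 in h1.
by rewrite (@lim_uniq R R[i]^o _ _ _ h1 h2) subrr.
Unshelve. all: by end_near. Qed.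

End Projection.

(** * Extreme linear minorants of sublinear functionals

    Complex spaces are used here as real ones, through the scalars [r%:C]. *)

Section Sublinear.
Variables (R : realType) (V : lmodType R[i]).
Implicit Types (p q : V -> R) (f g : V -> R) (x y a : V) (r s t : R) (D : set V).

Definition sublinear p := (forall x y, p (x + y) <= p x + p y) /\
  forall r x, 0 <= r -> p (r%:C%C *: x) = r * p x.

Definition real_linear f := (forall x y, f (x + y) = f x + f y) /\
  forall r x, f (r%:C%C *: x) = r * f x.

Let C0 : 0%:C%C = 0 :> R[i]. Proof. by []. Qed.

Lemma sublinear0 p : sublinear p -> p 0 = 0.
Proof. by case=> _ h; rewrite -(scale0r 0) -C0 h// mul0r. Qed.

Lemma sublinear_ge p x : sublinear p -> - p (- x) <= p x.
Proof.
move=> ps; rewrite lerNl -subr_ge0 opprK addrC.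
by have := ps.1 x (- x); rewrite subrr sublinear0.
Qed.

Lemma sublinearP p : p 0 = 0 -> (forall x y, p (x + y) <= p x + p y) ->
  (forall r x, 0 < r -> r * p x <= p (r%:C%C *: x)) -> sublinear p.
Proof.
move=> p0 pD pZ; split=> // r x; rewrite le_eqVlt => /predU1P[<-|r0].
  by rewrite C0 scale0r p0 mul0r.
apply/le_anti/andP; split; last exact: pZ.
have ri : 0 < r^-1 by rewrite invr_gt0.
have := pZ _ (r%:C%C *: x) ri; rewrite scalerA -rmorphM/= mulVf ?gt_eqF// scale1r.
by rewrite mulrC ler_pdivrMr// mulrC.
Qed.

(** The linear functionals below [touch q a] are those below [q] that take the
    value [q a] at [a]: passing from [q] to [touch q a] is passing from a
    compact convex set to the face on which evaluation at [a] is maximal. *)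
Definition touch q a x := inf [set q (x + t%:C%C *: a) - t * q a | t in [set t | 0 <= t]].

Let touch_lb q a x : sublinear q ->
  lbound [set q (x + t%:C%C *: a) - t * q a | t in [set t | 0 <= t]] (- q (- x)).
Proof.
move=> qs _ [t /= t0 <-]; rewrite -(qs.2 _ _ t0) lerBrDr addrC lerBlDr.
by have := qs.1 (x + t%:C%C *: a) (- x); rewrite addrAC subrr add0r.
Qed.

Lemma touch_le q a x t : sublinear q -> 0 <= t ->
  touch q a x <= q (x + t%:C%C *: a) - t * q a.
Proof.
move=> qs t0; apply: ge_inf; first by exists (- q (- x)); exact: touch_lb.
by exists t.
Qed.

Lemma le_touch q a x m : (forall t, 0 <= t -> m <= q (x + t%:C%C *: a) - t * q a) ->
  m <= touch q a x.
Proof.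
move=> h; apply: lb_le_inf; first by eexists; exists 0 => /=.
by move=> _ [t /= t0 <-]; exact: h.
Qed.

Lemma touch_le_self q a x : sublinear q -> touch q a x <= q x.
Proof.
by move=> qs; have := touch_le a x qs (lexx 0); rewrite C0 scale0r addr0 mul0r subr0.
Qed.

Lemma touch_opp q a : sublinear q -> touch q a (- a) <= - q a.
Proof.
move=> qs; have := touch_le a (- a) qs ler01.
by rewrite scale1r addNr (sublinear0 qs) mul1r sub0r.
Qed.

Lemma touch_sublinear q a : sublinear q -> sublinear (touch q a).
Proof.
move=> qs; apply: sublinearP.
- apply/le_anti/andP; split; last first.
    by apply: le_touch => t t0; rewrite add0r (qs.2 _ _ t0) subrr.
  by rewrite -(sublinear0 qs); exact: touch_le_self.
- move=> x y; rewrite -lerBlDr; apply: le_touch => s s0.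
  rewrite lerBlDr -lerBlDl; apply: le_touch => t t0; rewrite lerBlDl.
  rewrite (le_trans (touch_le a (x + y) qs (addr_ge0 s0 t0)))//.
  rewrite mulrDl opprD addrACA lerD2r rmorphD scalerDl addrACA; exact: qs.1.
- move=> r x r0; apply: le_touch => t t0.
  have E : r * (t / r) = t by rewrite mulrCA mulfV ?mulr1// gt_eqF.
  have := touch_le a x qs (divr_ge0 t0 (ltW r0)); rewrite -(ler_pM2l r0) => /le_trans; apply.
  rewrite mulrBr -(qs.2 _ _ (ltW r0)) scalerDr scalerA -rmorphM/= E mulrA E.
  exact: lexx.
Qed.

(** The linear functionals below [q], restricted to [D], form a face among
    those below [p]. *)
Definition relative_face D p q := forall f g t, real_linear f -> real_linear g ->
  (forall x, f x <= p x) -> (forall x, g x <= p x) -> 0 < t < 1 ->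
  (forall x, D x -> t * f x + (1 - t) * g x <= q x) -> forall x, D x -> f x <= q x.

Lemma relative_faceC D p q f g t : relative_face D p q -> real_linear f -> real_linear g ->
  (forall x, f x <= p x) -> (forall x, g x <= p x) -> 0 < t < 1 ->
  (forall x, D x -> t * f x + (1 - t) * g x <= q x) -> forall x, D x -> g x <= q x.
Proof.
move=> qf fl gl fp gp /andP[t0 t1] h; apply: (qf g f (1 - t)) => //.
  by rewrite subr_gt0 t1 ltrBlDl ltrDr t0.
by move=> x Dx; rewrite opprB addrCA subrr addr0 addrC; exact: h.
Qed.

Lemma linear_subspaceN D x : linear_subspace D -> D x -> D (- x).
Proof. by move=> [D0 DP] Dx; rewrite -scaleN1r -[_ *: _]addr0; exact: DP. Qed.

Lemma real_linearN f x : real_linear f -> f (- x) = - f x.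
Proof. by case=> _ /(_ (-1) x); rewrite rmorphN scaleN1r mulN1r. Qed.

(** If [t * f + (1 - t) * g <= touch q a] on [D], then [f] and [g] are below
    [q] on [D], and the average is at least [q a] at [a]; hence both take the
    value [q a] there. *)
Lemma touch_face D p q a : linear_subspace D -> sublinear q -> D a ->
  relative_face D p q -> relative_face D p (touch q a).
Proof.
move=> Dlin qs Da qf f g t fl gl fp gp t01 h.
have hq x : D x -> t * f x + (1 - t) * g x <= q x.
  by move=> Dx; rewrite (le_trans (h x Dx))// touch_le_self.
have fq := qf f g t fl gl fp gp t01 hq.
have gq := relative_faceC qf fl gl fp gp t01 hq.
have fa : q a <= f a.
  have := le_trans (h _ (linear_subspaceN Dlin Da)) (touch_opp a qs).
  rewrite !real_linearN// !mulrN -opprD lerN2 => qa.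
  move: t01 => /andP[t0 t1]; have ga := gq a Da.
  have ga' : (1 - t) * g a <= (1 - t) * q a by rewrite ler_wpM2l// subr_ge0 ltW.
  have : t * q a <= t * f a by lra.
  by rewrite ler_pM2l.
move=> x Dx; apply: le_touch => s s0; rewrite lerBrDr.
apply: (@le_trans _ _ (f x + s * f a)); first by rewrite lerD2l ler_wpM2l.
by rewrite -fl.2 -fl.1; apply: fq; rewrite addrC; exact: Dlin.2.
Qed.

Definition face_functional D p q :=
  [/\ sublinear q, forall x, q x <= p x & relative_face D p q].

(** A minimal element [q] of the functionals that define faces relative to
    [D] is linear. It equals [touch q a] for [a] in [D], hence is odd on [D];
    and then [touch q a] has the same restriction to [D] as [q] for every [a], so
    that it still defines a face relative to [D], and [q] is odd everywhere. A
    sublinear odd functional is linear. Thus [f = q] is extreme after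
    restriction to [D] while being dominated by [p] on the whole of [V]. *)
Lemma extreme_minorant p D : sublinear p -> linear_subspace D ->
  exists2 f, real_linear f /\ (forall x, f x <= p x) &
  forall g h t, real_linear g -> real_linear h ->
    (forall x, g x <= p x) -> (forall x, h x <= p x) -> 0 < t < 1 ->
    (forall x, D x -> f x = t * g x + (1 - t) * h x) -> forall x, D x -> g x = f x.
Proof.
move=> ps Dlin.
pose T := {q | face_functional D p q}.
pose le_T (u v : T) := `[< forall x, sval v x <= sval u x >].
have pgood : face_functional D p p by split=> // f g t fl gl fp gp t01 _ x _; exact: fp.
have [||||[q [qs qp qf]] qmin] := @Zorn T le_T.
- by move=> u; apply/asboolP.
- move=> u v w /asboolP uv /asboolP vw; apply/asboolP => x; exact: le_trans (vw x) (uv x).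
- move=> [u hu] [v hv] /asboolP/= uv /asboolP/= vu.
  have E : u = v by apply/funext => x; apply/le_anti/andP.
  by subst v; congr exist; exact: Prop_irrelevance.
(* the infimum of a chain; an empty chain is bounded by p *)
- move=> A Atot; have [/forallNP A0|/contrapT[u0 Au0]] := pselect (~ exists u, A u).
    by exists (exist _ p pgood) => u /A0.
  pose vals x := [set sval u x | u in A].
  pose qi x := inf (vals x).
  have vlb x : has_lbound (vals x).
    exists (- p (- x)) => _ [[u [us up uf]] Au <-] /=.
    by rewrite (le_trans _ (sublinear_ge x us))// lerN2.
  have qi_le u x : A u -> qi x <= sval u x.
    by move=> Au; apply: ge_inf => //; exists u.
  have le_qi x m : (forall u, A u -> m <= sval u x) -> m <= qi x.
    move=> h; apply: lb_le_inf; first by exists (sval u0 x); exists u0.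
    by move=> _ [u Au <-]; exact: h.
  have sl (u : T) : sublinear (sval u) by case: u => q0 [].
  have gi : face_functional D p qi.
    split.
    + apply: sublinearP.
      * apply/le_anti/andP; split; first by rewrite -(sublinear0 (sl u0)) qi_le.
        by apply: (le_qi) => u Au; rewrite (sublinear0 (sl u)).
      * move=> x y; rewrite -lerBlDr; apply: (le_qi) => u Au.
        rewrite lerBlDr -lerBlDl; apply: (le_qi) => v Av; rewrite lerBlDl.
        have [/asboolP uv|/asboolP vu] := Atot u v Au Av.
          by rewrite (le_trans (qi_le v _ Av))// (le_trans ((sl v).1 _ _))// lerD2r.
        by rewrite (le_trans (qi_le u _ Au))// (le_trans ((sl u).1 _ _))// lerD2l.
      * move=> r x r0; apply: (le_qi) => u Au.
        by rewrite ((sl u).2 _ _ (ltW r0)) ler_pM2l// qi_le.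
    + by move=> x; rewrite (le_trans (qi_le u0 x Au0))//; case: (u0) => q0 [].
    + move=> f g t fl gl fp gp t01 h x Dx; apply: (le_qi) => -[u [us up uf]] Au /=.
      apply: (uf f g t) => // y Dy; rewrite (le_trans (h y Dy))//.
      exact: (qi_le _ y Au).
  by exists (exist _ qi gi) => u Au; apply/asboolP => x /=; exact: qi_le.
have qmin' a : relative_face D p (touch q a) -> touch q a = q.
  move=> tf.
  have tg : face_functional D p (touch q a).
    split=> //; first exact: touch_sublinear.
    by move=> x; rewrite (le_trans (touch_le_self a x qs)).
  have := qmin (exist _ _ tg).
  have h : le_T (exist (face_functional D p) q (And3 qs qp qf)) (exist (face_functional D p) _ tg).
    by apply/asboolP => x /=; exact: touch_le_self.
  by move=> /(_ h) /(congr1 sval).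
have qoppD a : D a -> q (- a) <= - q a.
  move=> Da; rewrite -{1}(qmin' a); first exact: touch_opp.
  exact: touch_face.
have qopp a : q (- a) <= - q a.
  rewrite -{1}(qmin' a); first exact: touch_opp.
  move=> f g t fl gl fp gp t01 h x Dx.
  apply: (@le_trans _ _ (q x)).
    apply: (qf f g t) => // y Dy; rewrite (le_trans (h y Dy))//; exact: touch_le_self.
  have := sublinear_ge x (touch_sublinear a qs); apply: le_trans.
  rewrite lerNr (le_trans (touch_le_self a _ qs))//; exact/qoppD.
have ql : real_linear q.
  split=> [x y|r x].
    apply/le_anti/andP; split; first exact: qs.1.
    have := qs.1 (x + y) (- y); rewrite addrK; have := qopp y; lra.
  have [r0|/ltW r0] := leP 0 r; first exact: qs.2.
  have nr : 0 <= - r by rewrite oppr_ge0.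
  have E : r%:C%C *: x = - ((- r)%:C%C *: x) by rewrite rmorphN scaleNr opprK.
  have := qopp ((- r)%:C%C *: x); have := sublinear_ge (r%:C%C *: x) qs.
  rewrite E opprK (qs.2 _ _ nr) mulNr opprK => h1 h2.
  by apply/le_anti/andP.
exists q => // g h t gl hl gp hp t01 E x Dx.
have hle y : D y -> g y <= q y.
  by apply: (qf g h t) => // z Dz; rewrite E.
apply/le_anti/andP; split; first exact: hle.
by have := hle _ (linear_subspaceN Dlin Dx); rewrite !real_linearN// lerN2.
Qed.

End Sublinear.

(** * States of B(H) *)

Section Adjoints.
Variables (R : realType) (H : hilbert R).
Implicit Types (x y z : bop H) (a : R[i]) (h : H).

Lemma bop_adjPr x (h g : H) : '[h, x g] = '[adj x h, g].
Proof. by rewrite innerC adjP -innerC. Qed.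

Lemma bop_adjK x : adj (adj x) = x.
Proof. by symmetry; apply: adj_unique => h g; rewrite bop_adjPr. Qed.

Lemma bop_adjM x y : adj (x * y) = adj y * adj x.
Proof. by symmetry; apply: adj_unique => h g; rewrite !bop_mulE !adjP. Qed.

Lemma bop_adjD x y : adj (x + y) = adj x + adj y.
Proof.
by symmetry; apply: adj_unique => h g; rewrite !bop_addE innerDl innerDr !adjP.
Qed.

Lemma bop_adjZ a x : adj (a *: x) = a^* *: adj x.
Proof.
by symmetry; apply: adj_unique => h g; rewrite !bop_scaleE innerZl innerZr conjCK adjP.
Qed.

Lemma bop_adj1 : adj (1 : bop H) = 1.
Proof. by symmetry; apply: adj_unique. Qed.

Lemma bop_adj_self h x : '[(adj x * x) h, h] = `|x h| ^+ 2.
Proof. by rewrite bop_mulE -bop_adjPr sqr_normE. Qed.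

End Adjoints.

Section States.
Variables (R : realType) (H : hilbert R).
Implicit Types (x y z : bop H) (a : R[i]) (h : H).

Definition num_sup x : R := sup [set complex.Re '[x h, h] | h in [set h : H | `|h| = 1]].

Definition state (w : bop H -> R[i]) :=
  [/\ forall a x y, w (a *: x + y) = a * w x + w y,
      forall x, w (adj x) = (w x)^*,
      forall x, positive_op x -> 0 <= w x & w 1 = 1].

Lemma state0 w : state w -> w 0 = 0.
Proof.
move=> [wl _ _ _]; have := wl 1 0 0; rewrite scaler0 addr0 mul1r => /eqP.
by rewrite -subr_eq subrr eq_sym => /eqP.
Qed.

Lemma stateZ w a x : state w -> w (a *: x) = a * w x.
Proof. by move=> ws; have [wl _ _ _] := ws; rewrite -[_ *: x]addr0 wl state0// addr0. Qed.

Lemma stateD w x y : state w -> w (x + y) = w x + w y.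
Proof. by move=> [wl _ _ _]; rewrite -[x in LHS]scale1r wl mul1r. Qed.

Lemma stateB w x y : state w -> w (x - y) = w x - w y.
Proof. by move=> ws; rewrite stateD// -[- y]scaleN1r stateZ// mulN1r. Qed.

Let Re_le (z w : R[i]) : z <= w -> complex.Re z <= complex.Re w.
Proof. by rewrite lecE => /andP[]. Qed.

Let Re_norm (z : R[i]) : complex.Re z <= complex.Re `|z|.
Proof.
have := normc_ge_Re z => /Re_le /=; exact: le_trans (ler_norm _).
Qed.

Lemma num_sup_ge x h : `|h| = 1 -> complex.Re '[x h, h] <= num_sup x.
Proof.
move=> h1; apply: sup_ubound; last by exists h.
exists (opnorm x) => _ [g /= g1 <-]; apply: le_trans (Re_norm _) _.
have := cauchy_schwarz (x g) g; rewrite g1 mulr1 => /le_trans/(_ (le_opnorm x g)).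
by rewrite g1 mulr1 => /Re_le.
Qed.

Hypothesis H_neq0 : exists h : H, h != 0.

Lemma num_sup_le x m : (forall h, `|h| = 1 -> complex.Re '[x h, h] <= m) -> num_sup x <= m.
Proof.
move=> hm; apply: ge_sup; last by move=> _ [h /= h1 <-]; exact: hm.
have [h h0] := H_neq0; pose g := `|h|^-1 *: h.
exists (complex.Re '[x g, g]); exists g => //=.
by rewrite /g normrZ normfV normr_id mulVf// normr_eq0.
Qed.

Let ReD (z w : R[i]) : complex.Re (z + w) = complex.Re z + complex.Re w.
Proof. by case: z w => ? ? []. Qed.

Let ReZ (r : R) (w : R[i]) : complex.Re (r%:C%C * w) = r * complex.Re w.
Proof. by case: w => ? ? /=; rewrite mul0r subr0. Qed.

Lemma num_sup_sublinear : sublinear num_sup.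
Proof.
apply: sublinearP.
- apply/le_anti/andP; split.
    by apply: num_sup_le => h _; rewrite bop_zeroE inner0l.
  have [h h0] := H_neq0; pose g := `|h|^-1 *: h.
  have g1 : `|g| = 1 by rewrite /g normrZ normfV normr_id mulVf// normr_eq0.
  by have := num_sup_ge 0 g1; rewrite bop_zeroE inner0l.
- move=> x y; apply: num_sup_le => h h1; rewrite bop_addE innerDl ReD.
  by rewrite lerD// num_sup_ge.
- move=> r x r0; rewrite mulrC -ler_pdivlMr//; apply: num_sup_le => h h1.
  rewrite ler_pdivlMr// mulrC -ReZ -innerZl -bop_scaleE; exact: num_sup_ge.
Qed.

Lemma conjcE (z : R[i]) : z^* = conjc z.
Proof. by []. Qed.

(** A real functional [f] below [num_sup] is turned into the complex one
    [x |-> f x - 'i * f ('i *: x)]. Now [f] vanishes on operators whose quadratic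
    form has zero real part: this makes the complex functional hermitian, and
    real on positive operators. *)
Lemma state_of_minorant (f : bop H -> R) : real_linear f -> (forall x, f x <= num_sup x) ->
  exists2 w, state w & forall x, complex.Re (w x) = f x.
Proof.
move=> fl fp; have [fD fZ] := fl.
exists (fun x => (f x +i* (- f ('i%C *: x)))%C) => //.
have le0 x : (forall h, complex.Re '[x h, h] <= 0) -> f x <= 0.
  by move=> hx; apply: (le_trans (fp x)); apply: num_sup_le.
have eq0 x : (forall h, complex.Re '[x h, h] = 0) -> f x = 0.
  move=> hx; apply/le_anti; rewrite le0 => [|h]; last by rewrite hx.
  rewrite -oppr_le0 -(real_linearN _ fl) le0// => h.
  by rewrite bop_oppE -scaleN1r innerZl mulN1r raddfN/= hx oppr0.
have fa x : f (adj x) = f x.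
  apply/eqP; rewrite -subr_eq0 -(real_linearN _ fl) -fD; apply/eqP/eq0 => h.
  rewrite bop_subE innerBl -bop_adjPr innerC; case: ('[x h, h]) => u v /=.
  by rewrite subrr.
have sc a x : f (a *: x) = complex.Re a * f x + complex.Im a * f ('i%C *: x).
  by rewrite [a in LHS]complexE scalerDl fD fZ (mulrC 'i%C) -scalerA fZ.
split.
- move=> a x y; rewrite scalerDr !fD scalerA sc (sc (_ * a)).
  case: a => u v /=; rewrite !mul0r !mul1r sub0r add0r.
  by apply/eqP; rewrite eq_complex /=; apply/andP; split; apply/eqP; ring.
- move=> x; rewrite fa.
  have -> : 'i%C *: adj x = - adj ('i%C *: x).
    rewrite bop_adjZ (_ : ('i%C)^* = - 'i%C) ?scaleNr ?opprK//.
    by apply/eqP; rewrite eq_complex /= oppr0 !eqxx.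
  by rewrite (real_linearN _ fl) fa.
- move=> x px; have r0 h : complex.Im '[x h, h] = 0 by rewrite ger0_Im.
  have -> : f ('i%C *: x) = 0.
    apply: eq0 => h; rewrite bop_scaleE innerZl.
    by move: (r0 h); case: ('[x h, h]) => u v /= ->; rewrite mul0r mulr0 subrr.
  rewrite oppr0 lecE /= eqxx /= -oppr_le0 -(real_linearN _ fl); apply: le0 => h.
  have := px h; rewrite bop_oppE -scaleN1r innerZl mulN1r raddfN/= oppr_le0.
  by rewrite lecE => /andP[].
- have f1 : f 1 = 1.
    apply/le_anti/andP; split.
      apply: (le_trans (fp _)); apply: num_sup_le => h h1.
      by rewrite bop_oneE -sqr_normE h1 expr1n.
    rewrite -lerN2 -(real_linearN _ fl); apply: (le_trans (fp _)).
    apply: num_sup_le => h h1.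
    by rewrite bop_oppE bop_oneE -scaleN1r innerZl -sqr_normE h1 expr1n mulr1.
  have -> : f ('i%C *: (1 : bop H)) = 0.
    apply: eq0 => h; rewrite bop_scaleE innerZl bop_oneE.
    have : complex.Im '[h, h] = 0 by rewrite ger0_Im// -sqr_normE exprn_ge0.
    by case: ('[h, h]) => u v /= ->; rewrite mul0r mulr0 subrr.
  by rewrite f1 oppr0.
Qed.

(** Apply positivity of [w] to [num_sup x - (x + adj x) / 2]. *)
Lemma state_le_num_sup w x : state w -> complex.Re (w x) <= num_sup x.
Proof.
move=> ws; have [_ wa wp w1] := ws.
pose y : bop H := (num_sup x)%:C%C *: (1 : bop H) + ((-2^-1 : R[i]) *: x + (-2^-1 : R[i]) *: adj x).
have yp : positive_op y.
  move=> h; rewrite !bop_addE !bop_scaleE bop_oneE !innerDl !innerZl -bop_adjPr.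
  rewrite (innerC h (x h)) -mulrDr.
  have -> : '[x h, h] + ('[x h, h])^* = 2 * (complex.Re '[x h, h])%:C%C by exact: addcJ.
  rewrite mulrA mulNr mulVf ?pnatr_eq0// mulN1r subr_ge0.
  have [->|h0] := eqVneq h 0; first by rewrite linear0 !inner0l mulr0.
  pose g := `|h|^-1 *: h.
  have nh : `|h| != 0 by rewrite normr_eq0.
  have g1 : `|g| = 1 by rewrite /g normrZ normfV normr_id mulVf.
  have hg : h = `|h| *: g by rewrite /g scalerA mulfV// scale1r.
  have [r rE] : exists r : R, `|h| = r%:C%C.
    by exists (complex.Re `|h|); rewrite RRe_real// normr_real.
  have xE : '[x h, h] = (r ^+ 2)%:C%C * '[x g, g].
    have xh : x h = r%:C%C *: x g by rewrite {1}hg rE linearZ.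
    rewrite xh [X in inner _ _ X]hg rE innerZl innerZr conjcE conjc_real mulrA.
    by rewrite -rmorphM expr2.
  rewrite xE -sqr_normE rE -rmorphXn/= ReZ -rmorphM lecR mulrC.
  by rewrite ler_wpM2r ?sqr_ge0// num_sup_ge.
have := wp y yp; rewrite !stateD// !stateZ// w1 mulr1 wa -mulrDr.
have -> : w x + (w x)^* = 2 * (complex.Re (w x))%:C%C by exact: addcJ.
by rewrite mulrA mulNr mulVf ?pnatr_eq0// mulN1r subr_ge0 lecR.
Qed.

(** The restriction of [w] to [D] is pure, although [w] itself need not be. The
    competitors [w1] and [w2] are states of [B(H)] because the functionals to
    which purity is applied, the vector states of the compressed GNS
    construction, are defined there. *)
Lemma exists_relatively_pure_state (D : set (bop H)) : linear_subspace D ->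
  exists2 w, state w & forall w1 w2 (t : R), state w1 -> state w2 -> 0 < t < 1 ->
    (forall x, D x -> w x = t%:C%C * w1 x + (1 - t)%:C%C * w2 x) ->
    forall x, D x -> w1 x = w x.
Proof.
move=> Dlin.
have [f [fl fp] fext] := extreme_minorant num_sup_sublinear Dlin.
have [w ws wf] := state_of_minorant fl fp.
exists w => // w1 w2 t s1 s2 t01 E.
have rl v : state v -> real_linear (fun x => complex.Re (v x)).
  move=> vs; split=> [x y|r x]; first by rewrite stateD// ReD.
  by rewrite stateZ// ReZ.
have re x : D x -> complex.Re (w1 x) = complex.Re (w x).
  move=> Dx; rewrite wf.
  apply: (fext _ _ t (rl _ s1) (rl _ s2)) => // [y|y|y Dy].
  - exact: state_le_num_sup.
  - exact: state_le_num_sup.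
  - by rewrite -wf E// ReD !ReZ.
move=> x Dx.
have Dix : D ('i%C *: x) by case: Dlin => D0 DP; rewrite -[_ *: x]addr0; exact: DP.
have im v : state v -> complex.Re (v ('i%C *: x)) = - complex.Im (v x).
  by move=> vs; rewrite stateZ// mulrC ReiNIm.
apply/eqP; rewrite eq_complex re// eqxx/=; apply/eqP/oppr_inj.
by rewrite -!im// re.
Qed.

End States.

(** * The compressed GNS construction *)

Lemma bop_dense_ext (R : realType) (L : hilbert R) (V : Type) (j : V -> L) (X Y : bop L) :
  dense_map j -> (forall b c, '[X (j b), j c] = '[Y (j b), j c]) -> X = Y.
Proof.
move=> jd h.
have hj b : X (j b) = Y (j b).
  apply/eqP; rewrite -subr_eq0; apply/eqP; apply: (dense_separates jd) => c.
  by rewrite innerC innerBl h subrr conjC0.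
apply: bopP => z; have [b hb] := dense_cvg z jd.
have hX := cvg_comp _ _ hb (@bop_continuous _ _ X z).
have hY := cvg_comp _ _ hb (@bop_continuous _ _ Y z).
apply: (lim_uniq hX); rewrite (_ : _ \o _ = Y \o (fun n => j (b n)))//.
by apply/funext => n /=.
Qed.

Lemma sum_cvg (R : realType) (I : Type) (r : seq I) (F : I -> nat -> R[i]^o)
    (l : I -> R[i]^o) : (forall i, F i @ \oo --> l i) ->
  (fun m => \sum_(i <- r) F i m) @ \oo --> \sum_(i <- r) l i.
Proof.
move=> Fl; elim: r => [|i r IH].
  rewrite big_nil (_ : (fun m => _) = fun _ => 0); first exact: cvg_cst.
  by apply/funext => m; rewrite big_nil.
rewrite big_cons (_ : (fun m => _) = fun m => F i m + \sum_(i <- r) F i m).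
  exact: (cvgD (Fl i) IH).
by apply/funext => m; rewrite big_cons.
Qed.

Lemma inner_suml (R : realType) (L : hilbert R) (I : Type) (r : seq I) (F : I -> L) (g : L) :
  '[\sum_(i <- r) F i, g] = \sum_(i <- r) '[F i, g].
Proof.
by apply: (big_morph (fun z : L => '[z, g])) => [? ?|]; rewrite ?innerDl ?inner0l.
Qed.

Section GNS.
Variables (R : realType) (H : hilbert R).
Implicit Types (x y z : bop H) (a : R[i]).

Definition unital_star_subalgebra (D : set (bop H)) :=
  [/\ linear_subspace D, forall x y, D x -> D y -> D (x * y),
      forall x, D x -> D (adj x) & D 1].

Lemma star_subalgebra_subspace D : unital_star_subalgebra D -> linear_subspace D.
Proof. by case. Qed.

Variables (w : bop H -> R[i]).
Hypothesis (ws : state w).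

Lemma state_sandwich_linear a x y z b :
  w (z * (a *: x + y) * b) = a * w (z * x * b) + w (z * y * b).
Proof.
rewrite -(stateZ _ _ ws) -(stateD _ _ ws); congr w; apply: bopP => h.
by rewrite bop_addE bop_scaleE !bop_mulE bop_addE bop_scaleE linearP.
Qed.

Let form_linear a x y z : w (adj z * (a *: x + y)) = a * w (adj z * x) + w (adj z * y).
Proof. by have := state_sandwich_linear a x y (adj z) 1; rewrite !mulr1. Qed.

Let form_herm x y : w (adj y * x) = (w (adj x * y))^*.
Proof. by have [_ wa _ _] := ws; rewrite -wa bop_adjM bop_adjK. Qed.

Let form_ge0 x : 0 <= w (adj x * x).
Proof. by have [_ _ wp _] := ws; apply: wp => h; rewrite bop_adj_self exprn_ge0. Qed.

Definition state_form : semi_inner (bop H) :=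
  @SemiInner R (bop H) (fun x y => w (adj y * x)) form_linear form_herm form_ge0.

(** The operator [`|x| ^+ 2 *: (adj b * b) - adj (x * b) * (x * b)] is
    positive, by the bound [`|x (b h)| <= `|x| * `|b h|]. *)
Lemma state_form_mul x b : snorm state_form (x * b) <= `|x| * snorm state_form b.
Proof.
rewrite -(@ler_pXn2r _ 2%N)// ?nnegrE ?mulr_ge0 ?snorm_ge0//.
rewrite exprMn !snormK /= -(stateZ _ _ ws) -subr_ge0 -(stateB _ _ ws).
have [_ _ wp _] := ws; apply: wp => h.
rewrite bop_subE innerBl bop_scaleE innerZl !bop_adj_self bop_mulE subr_ge0 -exprMn.
by rewrite ler_pXn2r// ?nnegrE ?mulr_ge0//; exact: le_opnorm.
Qed.

Lemma state_form_bound x b c :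
  `|w (adj c * x * b)| <= `|x| * snorm state_form b * snorm state_form c.
Proof.
rewrite -mulrA; have := snorm_cauchy_schwarz state_form (x * b) c => /le_trans; apply.
by rewrite ler_wpM2r ?snorm_ge0// state_form_mul.
Qed.

Variables (D : set (bop H)).
Hypothesis (hD : unital_star_subalgebra D).

Local Notation Dlin := (star_subalgebra_subspace hD).
Local Notation V := (subspace_type Dlin).
Local Notation val b := (subspace_val b : bop H).

(** Only the classes of elements of [D] enter [L], while the operators to be
    represented range over [B(H)]: for [x] in [B(H)] the operator [gns x]
    is the compression to [L] of left multiplication by [x]. *)
Lemma compressed_gns : exists (L : hilbert R) (j : V -> L) (gns : bop H -> bop L),
  [/\ linear j, dense_map j, forall b c : V, '[j b, j c] = w (adj (val c) * val b) &
      forall x (b c : V), '[gns x (j b), j c] = w (adj (val c) * x * val b)].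
Proof.
have vl (a : R[i]) (b c : V) :
    subspace_val (a *: b + c) = a *: subspace_val b + subspace_val c.
  exact: subspace_val_linear.
have k1 a (x y z : V) : state_form (val (a *: x + y)) (val z) =
    a * state_form (val x) (val z) + state_form (val y) (val z).
  by rewrite vl sform_linear.
have k2 (x y : V) : state_form (val x) (val y) = (state_form (val y) (val x))^* by exact: sformC.
have k3 (x : V) : 0 <= state_form (val x) (val x) by exact: sform_ge0.
pose k : semi_inner V := SemiInner k1 k2 k3.
have [L [j [jlin jk jd]]] := hilbert_completion k.
have jn b : `|j b| = snorm state_form (val b).
  apply/eqP; rewrite -(@eqrXn2 _ 2%N) ?snorm_ge0//.
  by rewrite sqr_normE jk snormK.
suff /choice[gns hT] : forall x, exists X : bop L,
    forall b c : V, '[X (j b), j c] = w (adj (val c) * x * val b) by exists L, j, gns.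
move=> x; apply: (@form_operator R L V j (fun b c : V => w (adj (val c) * x * val b)) `|x|) => //.
- move=> a b b' c; rewrite vl.
  by have := state_sandwich_linear a (val b) (val b') (adj (val c) * x) 1; rewrite !mulr1.
- move=> a b b' c; rewrite vl bop_adjD bop_adjZ -!mulrA.
  by have := state_sandwich_linear a^* (adj (val b)) (adj (val b')) 1 (x * val c); rewrite !mul1r.
- by move=> b c; rewrite !jn; exact: state_form_bound.
Qed.

Variables (L : hilbert R) (j : V -> L) (gns : bop H -> bop L).
Hypotheses (jlin : linear j) (jd : dense_map j).
Hypotheses (jw : forall b c : V, '[j b, j c] = w (adj (val c) * val b)).
Hypotheses (gnsP : forall x (b c : V), '[gns x (j b), j c] = w (adj (val c) * x * val b)).

Lemma gns_linear a x y : gns (a *: x + y) = a *: gns x + gns y.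
Proof.
apply: (bop_dense_ext jd) => b c.
by rewrite bop_addE bop_scaleE innerDl innerZl !gnsP state_sandwich_linear.
Qed.

Lemma gns_adj x : gns (adj x) = adj (gns x).
Proof.
apply: (bop_dense_ext jd) => b c.
have [_ wa _ _] := ws.
by rewrite -bop_adjPr [RHS]innerC !gnsP -wa !bop_adjM !bop_adjK !mulrA.
Qed.

Lemma gns_left_mul x (b b' : V) : val b' = x * val b -> gns x (j b) = j b'.
Proof.
move=> bb; apply/eqP; rewrite -subr_eq0; apply/eqP; apply: (dense_separates jd) => c.
by rewrite innerC innerBl gnsP jw bb mulrA subrr conjC0.
Qed.

(** Right factors in [D] map [D] to itself, where compression has no effect. *)
Lemma gns_mulr x d : D d -> gns (x * d) = gns x * gns d.
Proof.
move=> Dd; have [_ DM _ _] := hD; apply: (bop_dense_ext jd) => b c.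
have [b' bb] := in_subspace Dlin (DM _ _ Dd (subspaceP b)).
by rewrite bop_mulE (gns_left_mul bb) !gnsP bb !mulrA.
Qed.

Lemma gns1 : gns 1 = 1.
Proof.
by apply: (bop_dense_ext jd) => b c; rewrite gnsP mulr1 -jw.
Qed.

(** On vectors [j (b i)] the quadratic form of [gns] applied to [N] is [w]
    evaluated at [\sum_i \sum_k adj (b i) * N i k * b k], which is a positive
    operator; general vectors follow by density. *)
Lemma positive_mx_gns n (N : 'M[bop H]_n) : positive_mx N -> positive_mx (map_mx gns N).
Proof.
move=> Np x.
have /choice[b hb] i : exists b : nat -> V, (fun n => j (b n)) @ \oo --> x i.
  exact: dense_cvg.
apply: (@ge0_lim _ (fun m => \sum_(i < n) \sum_(k < n)
   '[gns (N i k) (j (b k m)), j (b i m)])) => [m|]; last first.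
  under eq_bigr do rewrite inner_suml.
  apply: sum_cvg => i; apply: sum_cvg => k; rewrite mxE.
  apply: inner_cvg (hb i).
  exact: cvg_comp _ _ (hb k) (@bop_continuous _ _ (gns (N i k)) (x k)).
pose y := \sum_(i < n) \sum_(k < n) adj (val (b i m)) * N i k * val (b k m).
have wsum I (r : seq I) (F : I -> bop H) : w (\sum_(i <- r) F i) = \sum_(i <- r) w (F i).
  by apply: (big_morph w (fun x y => stateD x y ws) (state0 ws)).
have -> : \sum_(i < n) \sum_(k < n) '[gns (N i k) (j (b k m)), j (b i m)] = w y.
  by rewrite wsum; apply: eq_bigr => i _; rewrite wsum; apply: eq_bigr => k _; rewrite gnsP.
have [_ _ wp _] := ws; apply: wp => h.
have := Np (fun i => val (b i m) h); congr (0 <= _).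
have bsum I (r : seq I) (F : I -> bop H) : (\sum_(i <- r) F i) h = \sum_(i <- r) F i h.
  by apply: (big_morph (fun z : bop H => z h)).
rewrite bsum inner_suml; apply: eq_bigr => i _; rewrite bsum !inner_suml; apply: eq_bigr => k _.
by rewrite !bop_mulE -bop_adjPr.
Qed.
Lemma positive_gns x : positive_op x -> positive_op (gns x).
Proof.
move=> xp v; have xm : positive_mx (const_mx x : 'M[bop H]_1).
  by move=> g; rewrite !big_ord1 mxE.
by have := positive_mx_gns xm (fun=> v); rewrite !big_ord1 !mxE.
Qed.

Lemma vector_state v : v != 0 -> state (fun x => '[gns x v, v] / '[v, v]).
Proof.
move=> v0; have vv : 0 < '[v, v] by rewrite -sqr_normE exprn_gt0// normr_gt0.
split.
- by move=> a x y; rewrite gns_linear bop_addE bop_scaleE innerDl innerZl mulrDl mulrA.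
- move=> x; rewrite gns_adj -bop_adjPr innerC rmorphM fmorphV/=; congr (_ / _).
  by rewrite -innerC.
- by move=> x /positive_gns xp; rewrite divr_ge0// ltW.
- by rewrite gns1 bop_oneE mulfV// gt_eqF.
Qed.

Variable (e : V).
Hypothesis (e1 : val e = 1).

Lemma gns_cyclic (b : V) : gns (val b) (j e) = j b.
Proof. by apply: gns_left_mul; rewrite e1 mulr1. Qed.

Lemma gns_cyclic_state x : '[gns x (j e), j e] = w x.
Proof. by rewrite gnsP e1 bop_adj1 mul1r mulr1. Qed.

Hypothesis (w_pure : forall w1 w2 (t : R), state w1 -> state w2 -> 0 < t < 1 ->
    (forall x, D x -> w x = t%:C%C * w1 x + (1 - t)%:C%C * w2 x) ->
    forall x, D x -> w1 x = w x).

(** Split the cyclic vector as [v + z] along an invariant subspace [E]. Both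
    parts give vector functionals, the cross terms vanish, and so [w] on
    [D] is a convex combination of the two vector states. If both parts are
    nonzero, purity gives [<gns x v, v> = r * w x] on [D] with [r = <v, v>], so
    that [v - r *: j e] is orthogonal to the orbit of the cyclic vector;
    hence the cyclic vector is in [E]. *)
Lemma gns_irreducible (E : set L) : linear_subspace E -> closed E ->
  (forall d v, D d -> E v -> E (gns d v)) -> E = [set 0] \/ E = setT.
Proof.
move=> El Ec Einv; have [E0 EP] := El; have [_ _ DA _] := hD.
have full : E (j e) -> E = setT.
  move=> Exi; apply/seteqP; split=> // u _.
  have [b hb] := dense_cvg u jd.
  apply: (@closed_cvg _ L _ _ _ E Ec _ _ hb); apply: nearW => n.
  by rewrite -gns_cyclic; apply: Einv => //; exact: subspaceP.
have [v Ev] := projection (j e) El Ec; move zE : (j e - v) => z vP.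
have xiE : j e = v + z by rewrite -zE addrC subrK.
have orth x : D x -> '[gns x v, z] = 0 by move=> Dx; apply: vP; exact: Einv.
have orth' x : D x -> '[gns x z, v] = 0.
  move=> Dx; rewrite innerC -[gns x]bop_adjK -gns_adj bop_adjPr bop_adjK orth ?conjC0//.
  exact: DA.
have wE x : D x -> w x = '[gns x v, v] + '[gns x z, z].
  move=> Dx; have TD : gns x (v + z) = gns x v + gns x z by exact: linearD.
  rewrite -gns_cyclic_state xiE TD innerDl !innerDr.
  by rewrite orth// orth'// addr0 add0r.
have [v0|v0] := eqVneq v 0.
  left; apply/seteqP; split=> [u Eu|_ ->//].
  apply: (dense_separates jd) => b; rewrite -gns_cyclic -[gns _]bop_adjK -bop_adjPr -gns_adj.
  rewrite xiE v0 add0r innerC vP ?conjC0//; apply: Einv => //.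
  by apply: DA; exact: subspaceP.
right; apply: full.
have [z0|z0] := eqVneq z 0; first by rewrite xiE z0 addr0.
have real (u : L) : exists r : R, '[u, u] = r%:C%C.
  by exists (complex.Re '[u, u]); rewrite RRe_real// ger0_real// -sqr_normE exprn_ge0.
have pos (u : L) : u != 0 -> 0 < '[u, u] by move=> u0; rewrite -sqr_normE exprn_gt0// normr_gt0.
have [r rE] := real v; have [s sE] := real z.
have r0 : 0 < r by rewrite -(@ltcR R) -rE; exact: pos.
have s0 : 0 < s by rewrite -(@ltcR R) -sE; exact: pos.
have rs : r + s = 1.
  have [_ _ _ w1] := ws; have [_ _ _ D1] := hD.
  have := wE _ D1; rewrite w1 gns1 !bop_oneE rE sE -rmorphD => h.
  by symmetry; exact: (@complexI R).
have wv x : D x -> '[gns x v, v] = r%:C%C * w x.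
  move=> Dx; rewrite -(w_pure (vector_state v0) (vector_state z0) (t := r))//.
  - by rewrite -rE mulrC divfK// gt_eqF// pos.
  - by rewrite r0 -rs ltrDl.
  - move=> y Dy; rewrite -rE (_ : (1 - r)%:C%C = '[z, z]); last first.
      by rewrite sE -rs addrAC subrr add0r.
    by rewrite ![_ * (_ / _)]mulrC !divfK ?gt_eqF ?pos//; exact: wE.
have vr : v = r%:C%C *: j e.
  apply/eqP; rewrite -subr_eq0; apply/eqP; apply: (dense_separates jd) => b.
  rewrite -gns_cyclic; set d := val b.
  have Dd : D (adj d) by apply: DA; exact: subspaceP.
  rewrite -[gns d]bop_adjK -bop_adjPr -gns_adj innerC.
  have -> : gns (adj d) (v - r%:C%C *: j e) = gns (adj d) v - r%:C%C *: gns (adj d) (j e).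
    by rewrite linearB linearZ.
  rewrite innerBl innerZl gns_cyclic_state -wv// [X in '[gns _ v, X]]xiE innerDr orth//.
  by rewrite addr0 subrr conjC0.
have -> : j e = r%:C%C^-1 *: v.
  by rewrite {1}vr scalerA mulVf ?scale1r// gt_eqF// ltcR.
by rewrite -[_ *: v]addr0; exact: EP.
Qed.

End GNS.

(** * The theorem *)

Lemma cstar_gen_sub (R : realType) (K : hilbert R) (S : set (bop K)) T : S T -> cstar_gen S T.
Proof. by move=> ST A [_]; exact. Qed.

Lemma cstar_gen_star_algebra (R : realType) (K : hilbert R) (S : set (bop K)) :
  S 1 -> unital_star_subalgebra (cstar_gen S).
Proof.
move=> S1; split; last exact: cstar_gen_sub.
- split=> [A [[[A0 _] _ _ _] _]//|a u v Su Sv A SA]; have [[[_ AP] _ _ _] _] := SA.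
  by apply: AP; [exact: Su|exact: Sv].
- move=> x y Sx Sy A SA; have [[_ AM _ _] _] := SA.
  by apply: AM; [exact: Sx|exact: Sy].
- move=> x Sx A SA; have [[_ _ AA _] _] := SA.
  by apply: AA; exact: Sx.
Qed.

Theorem theorem1p2 (R : realType) (K : hilbert R) (S : set (bop K))
    (opsysS : operator_system S)
    (all_boundary : forall (L : hilbert R) (sigma : bop K -> bop L),
       irreducible_representation (cstar_gen S) sigma ->
       boundary_representation S sigma)
    (H : hilbert R) (H_neq0 : exists x : H, x != 0)
    (pi : bop K -> bop H) (pi_rep : star_representation (cstar_gen S) pi)
    (pi_unital : pi 1 = 1)
    (Pi : bop K -> bop H) (Pi_cp : completely_positive (cstar_gen S) Pi)
    (Pi_unital : Pi 1 = 1)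
    (Pi_ext : forall T, S T -> Pi T = pi T) :
  forall X : bop H, ((fun T => pi T - Pi T) @` cstar_gen S) X ->
    ~ strictly_positive_op X.
Proof.
have [_ S1 _] := opsysS; have [[A0 AP] AM AA A1] := cstar_gen_star_algebra S1.
have [pil piM piA] := pi_rep; have [Pil Pip] := Pi_cp.
set A := cstar_gen S in A0 AP AM AA A1 pil piM piA Pil Pip *.
pose D : set (bop H) := pi @` A.
have pi0 : pi 0 = 0.
  have := pil (-1) 0 0 A0 A0; rewrite scaler0 addr0 scaleN1r addNr; exact.
have hD : unital_star_subalgebra D.
  split.
  - split; first by exists 0.
    move=> a _ _ [x Ax <-] [y Ay <-]; exists (a *: x + y); [exact: AP|exact: pil].
  - move=> _ _ [x Ax <-] [y Ay <-]; exists (x * y); [exact: AM|exact: piM].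
  - move=> _ [x Ax <-]; exists (adj x); [exact: AA|exact: piA].
  - by exists 1.
have Dlin : linear_subspace D by case: hD.
(* a state of B(H) that is pure on pi(A), and its compressed GNS map *)
have [w ws w_pure] := exists_relatively_pure_state H_neq0 Dlin.
have [L [j [gns [jlin jd jw gnsP]]]] := compressed_gns ws hD.
have [_ _ _ D1] := hD.
have [e e1] := in_subspace (star_subalgebra_subspace hD) D1.
move=> _ [T AT <-] [delta delta0 hdelta].
have irr : irreducible_representation A (gns \o pi).
  split; first split.
  - by move=> a x y Ax Ay /=; rewrite pil// (gns_linear ws jd gnsP).
  - move=> x y Ax Ay /=; rewrite piM// (gns_mulr jd jw gnsP)//; by exists y.
  - by move=> x Ax /=; rewrite piA// (gns_adj ws jd gnsP).
  split.
    exists 1 => //=; rewrite pi_unital (gns1 jd jw gnsP) => h.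
    have [_ _ _ w1] := ws; have := jw e e.
    rewrite -[j e]bop_oneE h inner0l e1 bop_adj1 mulr1 w1 => /esym/eqP.
    by rewrite oner_eq0.
  move=> E El Ec Einv; apply: (gns_irreducible ws jd jw gnsP e1 w_pure El Ec).
  by move=> _ v [x Ax <-]; exact: Einv.
have [_ /(_ (gns \o Pi))] := all_boundary _ _ irr.
have cp : completely_positive A (gns \o Pi).
  split=> [a x y Ax Ay /=|n M AM' Mp]; first by rewrite Pil// (gns_linear ws jd gnsP).
  by rewrite map_mx_comp; apply: (positive_mx_gns ws jd gnsP); exact: Pip.
move=> /(_ cp) h.
have /h/(_ T AT) /= : forall x, S x -> (gns \o Pi) x = (gns \o pi) x.
  by move=> x Sx /=; rewrite Pi_ext.
move=> /(congr1 (fun X : bop L => inner L (X (j e)) (j e))).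
rewrite !(gns_cyclic_state gnsP e1) => wE.
have [_ _ wp w1] := ws.
(* w vanishes at pi T - Pi T, but is at least delta there *)
have := wp _ hdelta; rewrite !stateB// stateZ// w1 wE mulr1 subrr sub0r oppr_ge0.
by move=> /le_gtF; rewrite ltcR delta0.
Qed.
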